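(* Let $\delta>0$ and $\varepsilon>0$ be fixed. Let $p$ be a prime and $e$ a positive integer with $e\mid p-1$ and $e\le p^{1-\delta}$. Suppose we are given a known set $S_0\subseteq\mathbb{F}_p$ with $\#S_0\le e$ and an oracle $\mathcal{O}_{e,s}$ for some unknown $s\in S_0$. Then there is a deterministic algorithm that makes $O(1)$ calls to the oracle $\mathcal{O}_{e,s}$ and finds $s$ in time $e^{1+\varepsilon}(\log p)^{O(1)}$, where the implied constants may depend on $\delta$ and $\varepsilon$.
   Context: For a prime $p$, a positive integer $e\mid p-1$ and a hidden element $s\in\mathbb{F}_p$, the oracle $\mathcal{O}_{e,s}$ is a black box which, on any input $x\in\mathbb{F}_p$, returns $\mathcal{O}_{e,s}(x)=(x+s)^e\in\mathbb{F}_p$. The task (Hidden Shifted Power Problem) is to find $s$. Running time counts bit operations, each oracle call having unit cost. *)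

(* Defs.v *)
From Stdlib Require Import Arith List Reals ZArith Znumtheory.
Local Open Scope nat_scope.
Import ListNotations.

Inductive instr : Type :=
| IConst (d k : nat)
| IAdd   (d a b : nat)
| ISub   (d a b : nat)      (* r_d := r_a - r_b   (truncated)            *)
| IMul   (d a b : nat)
| IDiv   (d a b : nat)      (* r_d := r_a / r_b   (x / 0 = 0)            *)
| IMod   (d a b : nat)      (* r_d := r_a mod r_b (x mod 0 = x)          *)
| ILoad  (d a : nat)
| IStore (a v : nat)
| IJz    (a l : nat)
| IQuery (d a : nat)
| IHalt.

Definition program := list instr.

Definition bitlen (n : nat) : nat := S (Nat.log2 n).

Record cfg : Type := Cfg {
  pc : nat;
  mem : nat -> nat;
  cost : nat;
  nqueries : nat
}.

Definition upd (m : nat -> nat) (i v : nat) : nat -> nat :=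
  fun j => if Nat.eqb j i then v else m j.

Definition step (prog : program) (O : nat -> nat) (c : cfg) : option cfg :=
  let m := mem c in
  let next d v k := Some (Cfg (S (pc c)) (upd m d v) (cost c + k) (nqueries c)) in
  match nth_error prog (pc c) with
  | None => None
  | Some IHalt => None
  | Some (IConst d k) => next d k (bitlen k)
  | Some (IAdd d a b) => next d (m a + m b) (bitlen (m a) + bitlen (m b))
  | Some (ISub d a b) => next d (m a - m b) (bitlen (m a) + bitlen (m b))
  | Some (IMul d a b) => next d (m a * m b) ((bitlen (m a) + bitlen (m b)) ^ 2)
  | Some (IDiv d a b) => next d (m a / m b) ((bitlen (m a) + bitlen (m b)) ^ 2)
  | Some (IMod d a b) => next d (m a mod m b) ((bitlen (m a) + bitlen (m b)) ^ 2)
  | Some (ILoad d a) => next d (m (m a)) (bitlen (m a) + bitlen (m (m a)))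
  | Some (IStore a v) =>
      Some (Cfg (S (pc c)) (upd m (m a) (m v))
                (cost c + (bitlen (m a) + bitlen (m v))) (nqueries c))
  | Some (IJz a l) =>
      Some (Cfg (if Nat.eqb (m a) 0 then l else S (pc c)) m (cost c + 1) (nqueries c))
  | Some (IQuery d a) =>
      Some (Cfg (S (pc c)) (upd m d (O (m a))) (cost c + 1) (S (nqueries c)))
  end.

Fixpoint exec (prog : program) (O : nat -> nat) (fuel : nat) (c : cfg) : option cfg :=
  match fuel with
  | 0 => None
  | S f => match step prog O c with
           | None => Some c
           | Some c' => exec prog O f c'
           end
  end.

(* Elements of F_p are represented by the naturals 0 <= x < p. *)
Definition hsp_oracle (p e s : nat) : nat -> nat :=
  fun x => ((x mod p + s) ^ e) mod p.

(* Input layout: r0 = p, r1 = e, r2 = #S0, r3, r4, ... = the elements of S0;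
   all other registers are 0.  The output is read in r0 when the machine halts. *)
Definition init_cfg (p e : nat) (S0 : list nat) : cfg :=
  Cfg 0 (fun i => match i with
                  | 0 => p
                  | 1 => e
                  | 2 => length S0
                  | S (S (S j)) => nth j S0 0
                  end) 0 0.

Definition nat_prime (p : nat) : Prop := Znumtheory.prime (Z.of_nat p).

(* Main.v *)
(** Let S be the set of elements of S0 that agree with the answers received so far. Asking x splits S
    into the classes of equal (x + u)^e, and one may search x = 0, 1, 2, ... for an x whose largest
    class is at most |S| / D, where D is a small power of e; since only s in S matters, O(1) such
    questions suffice. The search costs about |S| operations for each x tried, so x must be at most
    about e^(1 + eps) / |S|.

    This follows from a bound of Stepanov type: if w_1, ..., w_k are distinct and a_i <> 0, the number
    of y with (y + w_i)^e = a_i for all i is O(e^(1/2 + 1/(2k-2))). To prove it one takes a nonzero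
    combination of the products P_b(y) * prod_i (y + w_i)^(e b_i), 0 <= b_i < B, that vanishes to a
    high order at each such y; there it behaves like a polynomial of low degree, so there are few
    conditions. That the combination is not the zero polynomial is shown with Wronskians, which are
    controlled because all degrees stay below p (here e <= p^(1 - delta) is used).

    Applied with y = s and the k questions 0, ..., k - 1, the bound leaves |S| <= e^(1/2 + o(1)).
    Applied with y = 1 / (x + v_0) it shows that, for k + 1 fixed elements of S, only e^(1/2 + o(1))
    shifts x put all of them into one class; counting (k + 1)-subsets of S then yields a good x among
    the first e^(1/2 + o(1)). When |S| is at most about D^2, counting colliding pairs is enough. *)

Require Import Defs.
From Stdlib Require Import Arith List Reals ZArith Znumtheory Lia Lra.
From mathcomp Require all_boot all_order all_algebra perm.
From mathcomp Require zify ring.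
Open Scope R_scope.

Import ListNotations.
Local Open Scope nat_scope.

(** * Structured programs for the random access machine *)

(** One program serves all [p] and [e], so only [k] and constants made from it are built in, while
    [D] is computed at run time as an approximate root of [e], of order [K = (2k - 2)(k + 1)]. With
    [B = D^(k+1)] and [J = B^(k-1)] one has [J^2 = D^K], which is [e] up to a constant factor. This
    is the balance that the Stepanov argument asks for: [2 k J^2] has to stay below [e], and the
    number of solutions is about [e B / J]. Up to constants the candidates left number at most
    [e B / J] and the shift found is at most [e B^2 / J]. The product is [e B^3], and
    [B^3 = D^(3(k+1))] is at most [e^(3/(2k-2))], so [k] has to be large against [1/eps]. The real
    exponent [1 - delta] enters only through the integer inequality [e^(L+1) <= p^L], which leaves
    room for a factor [e^(1/L)] between [e] and [p]. If [D = 1], then [e] is below a constant and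
    cruder arguments suffice. Time is counted in instructions on numbers up to some [U] of order
    [p^2], each of which costs [O((log p)^2)] bit operations. *)

Inductive com : Type :=
| Do (i : instr)
| Seq (c1 c2 : com)
| When (r : nat) (c : com)
| Until (c : com) (r : nat).

Fixpoint code_size (c : com) : nat :=
  match c with
  | Do _ => 1
  | Seq c1 c2 => code_size c1 + code_size c2
  | When _ c => S (code_size c)
  | Until c _ => code_size c + 1
  end.

(** Jump targets are absolute, hence the load address [l]. The only jump fires on zero, so [When]
    skips on zero and [Until] repeats on zero. *)
Fixpoint compile (l : nat) (c : com) : program :=
  match c with
  | Do i => [i]
  | Seq c1 c2 => compile l c1 ++ compile (l + code_size c1) c2
  | When r c => IJz r (S l + code_size c) :: compile (S l) c
  | Until c r => compile l c ++ [IJz r l]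
  end.

Lemma length_compile c : forall l, length (compile l c) = code_size c.
Proof.
  induction c; intro l; simpl; rewrite ?length_app; simpl; auto.
Qed.

Definition effect (O : nat -> nat) (i : instr) (m : nat -> nat) : option (nat * nat) :=
  match i with
  | IConst d k => Some (d, k)
  | IAdd d a b => Some (d, m a + m b)
  | ISub d a b => Some (d, m a - m b)
  | IMul d a b => Some (d, m a * m b)
  | IDiv d a b => Some (d, m a / m b)
  | IMod d a b => Some (d, m a mod m b)
  | ILoad d a => Some (d, m (m a))
  | IStore a v => Some (m a, m v)
  | IQuery d a => Some (d, O (m a))
  | IJz _ _ | IHalt => None
  end.

Definition is_query (i : instr) : nat :=
  match i with IQuery _ _ => 1 | _ => 0 end.

(* [t] counts the instructions and [q] the queries; no value written exceeds [U], so that the bit cost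
   of a run is at most [t] times that of a single instruction on numbers up to [U]. *)
Inductive run (O : nat -> nat) (U : nat) : com -> (nat -> nat) -> (nat -> nat) -> nat -> nat -> Prop :=
| run_do i m d v : effect O i m = Some (d, v) -> v <= U -> run O U (Do i) m (upd m d v) 1 (is_query i)
| run_seq c1 c2 m m1 m2 t1 t2 q1 q2 :
    run O U c1 m m1 t1 q1 -> run O U c2 m1 m2 t2 q2 -> run O U (Seq c1 c2) m m2 (t1 + t2) (q1 + q2)
| run_when_skip r c m : m r = 0 -> run O U (When r c) m m 1 0
| run_when_do r c m m' t q : m r <> 0 -> run O U c m m' t q -> run O U (When r c) m m' (S t) q
| run_until_stop r c m m' t q :
    run O U c m m' t q -> m' r <> 0 -> run O U (Until c r) m m' (S t) q
| run_until_loop r c m m1 m2 t1 t2 q1 q2 :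
    run O U c m m1 t1 q1 -> m1 r = 0 -> run O U (Until c r) m1 m2 t2 q2 ->
    run O U (Until c r) m m2 (S t1 + t2) (q1 + q2).

Definition step_cost (U : nat) : nat := (2 * bitlen U) ^ 2.

Lemma bitlen_mono x y : x <= y -> bitlen x <= bitlen y.
Proof. intro H. apply le_n_S, Nat.log2_le_mono, H. Qed.

Lemma bitlen_pos x : 1 <= bitlen x.
Proof. unfold bitlen; lia. Qed.

Lemma sum_le_step_cost U x y : x <= bitlen U -> y <= bitlen U -> x + y <= step_cost U.
Proof.
  intros Hx Hy. unfold step_cost. rewrite Nat.pow_2_r. pose proof (bitlen_pos U). nia.
Qed.

Lemma sum_sq_le_step_cost U x y : x <= bitlen U -> y <= bitlen U -> (x + y) ^ 2 <= step_cost U.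
Proof. intros Hx Hy. apply Nat.pow_le_mono_l. lia. Qed.

Definition bounded (U : nat) (m : nat -> nat) : Prop := forall a, m a <= U.

Lemma bounded_upd U m d v : bounded U m -> v <= U -> bounded U (upd m d v).
Proof. intros Hm Hv a. unfold upd. destruct (Nat.eqb a d); auto. Qed.

Lemma step_effect prog O U m k q pc i d v :
  nth_error prog pc = Some i -> effect O i m = Some (d, v) -> v <= U -> bounded U m ->
  exists k', k' <= k + step_cost U /\
    step prog O (Cfg pc m k q) = Some (Cfg (S pc) (upd m d v) k' (is_query i + q)).
Proof.
  intros Hi He Hv Hm.
  assert (Hb : forall x, x <= U -> bitlen x <= bitlen U) by (intros; now apply bitlen_mono).
  pose proof (bitlen_pos U) as HU.
  assert (H1 : forall x, x <= bitlen U -> x <= step_cost U)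
    by (intros x Hx; pose proof (sum_le_step_cost U x x Hx Hx); lia).
  unfold step; cbn [Defs.pc mem cost nqueries]; rewrite Hi.
  destruct i; simpl in He; inversion He; subst; clear He; cbn [is_query Nat.add];
    eexists; (split; [|reflexivity]); apply Nat.add_le_mono_l;
    first [ apply sum_le_step_cost; apply Hb; auto
          | apply sum_sq_le_step_cost; apply Hb; auto
          | apply H1; auto ].
Qed.

(** * Correctness of compilation *)

Inductive steps (prog : program) (O : nat -> nat) : nat -> cfg -> cfg -> Prop :=
| steps_refl c : steps prog O 0 c c
| steps_cons n c c1 c2 : step prog O c = Some c1 -> steps prog O n c1 c2 -> steps prog O (S n) c c2.

Lemma steps_trans prog O n1 n2 a b c :
  steps prog O n1 a b -> steps prog O n2 b c -> steps prog O (n1 + n2) a c.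
Proof.
  induction 1; simpl; auto. intro. econstructor; eauto.
Qed.

Lemma steps_exec prog O n a b :
  steps prog O n a b -> step prog O b = None -> exec prog O (S n) a = Some b.
Proof.
  induction 1 as [c|n c c1 c2 Hs _ IH]; intro Hb.
  - simpl; rewrite Hb; reflexivity.
  - specialize (IH Hb). change (exec prog O (S (S n)) c) with
      (match step prog O c with None => Some c | Some c' => exec prog O (S n) c' end).
    rewrite Hs; exact IH.
Qed.

Definition code_at (prog : program) (l : nat) (c : program) : Prop :=
  exists pre post, prog = pre ++ c ++ post /\ length pre = l.

Lemma code_at_nth prog l i c : code_at prog l (i :: c) -> nth_error prog l = Some i.
Proof.
  intros (pre & post & -> & <-). rewrite nth_error_app2 by lia.
  now rewrite Nat.sub_diag.
Qed.

Lemma code_at_app prog l c1 c2 :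
  code_at prog l (c1 ++ c2) -> code_at prog l c1 /\ code_at prog (l + length c1) c2.
Proof.
  intros (pre & post & -> & <-). split.
  - exists pre, (c2 ++ post). now rewrite <- app_assoc.
  - exists (pre ++ c1), post. rewrite length_app. now rewrite <- !app_assoc.
Qed.

(** The code may sit at any address of a larger program and control always leaves it at its end;
    this generality is what lets sequences and loops compose. *)
Lemma run_steps O U c m m' t q : run O U c m m' t q ->
  forall prog l k q0, code_at prog l (compile l c) -> bounded U m ->
  exists n k', k' <= k + t * step_cost U /\ bounded U m' /\
    steps prog O n (Cfg l m k q0) (Cfg (l + code_size c) m' k' (q + q0)).
Proof.
  assert (Hc1 : 1 <= step_cost U).
  { unfold step_cost. rewrite Nat.pow_2_r. pose proof (bitlen_pos U). nia. }
  assert (Hjz : forall prog pc r t0 m k q0, nth_error prog pc = Some (IJz r t0) ->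
     step prog O (Cfg pc m k q0) = Some (Cfg (if Nat.eqb (m r) 0 then t0 else S pc) m (k + 1) q0)).
  { intros. unfold step. cbn [Defs.pc mem cost nqueries]. now rewrite H. }
  induction 1 as [i m d v He Hv|c1 c2 m m1 m2 t1 t2 q1 q2 _ IH1 _ IH2|r c m Hr|r c m m' t q Hr _ IH
    |r c m m' t q _ IH Hr|r c m m1 m2 t1 t2 q1 q2 _ IH1 Hr _ IH2];
    intros prog l k q0 Hcode Hm; cbn [compile code_size] in Hcode |- *.
  - destruct (step_effect prog O U m k q0 l i d v (code_at_nth _ _ _ _ Hcode) He Hv Hm) as (k' & Hk & Hs).
    exists 1, k'. repeat split; [lia|now apply bounded_upd|].
    rewrite Nat.add_1_r. econstructor; [exact Hs|constructor].
  - apply code_at_app in Hcode as [Hcode1 Hcode2]. rewrite length_compile in Hcode2.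
    destruct (IH1 _ _ k q0 Hcode1 Hm) as (n1 & k1 & Hk1 & Hm1 & Hs1).
    destruct (IH2 _ _ k1 (q1 + q0) Hcode2 Hm1) as (n2 & k2 & Hk2 & Hm2 & Hs2).
    exists (n1 + n2), k2. repeat split; [lia|assumption|].
    rewrite Nat.add_assoc. replace (q1 + q2 + q0) with (q2 + (q1 + q0)) by lia.
    eapply steps_trans; eassumption.
  - exists 1, (k + 1). repeat split; [lia|assumption|].
    econstructor; [rewrite (Hjz _ _ _ _ _ _ _ (code_at_nth _ _ _ _ Hcode)), Hr; reflexivity|].
    rewrite (Nat.add_succ_r l). constructor.
  - pose proof (code_at_nth _ _ _ _ Hcode) as Hi.
    apply (code_at_app _ _ [_]) in Hcode as [_ Hcode]. cbn [length] in Hcode.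
    rewrite Nat.add_1_r in Hcode.
    destruct (IH _ _ (k + 1) q0 Hcode Hm) as (n & k' & Hk & Hm' & Hs).
    exists (S n), k'. repeat split; [lia|assumption|].
    econstructor; [rewrite (Hjz _ _ _ _ _ _ _ Hi)|].
    + apply Nat.eqb_neq in Hr. rewrite Hr. reflexivity.
    + rewrite (Nat.add_succ_r l). exact Hs.
  - apply code_at_app in Hcode as [Hcode1 Hcode2]. rewrite length_compile in Hcode2.
    destruct (IH _ _ k q0 Hcode1 Hm) as (n & k' & Hk & Hm' & Hs).
    exists (n + 1), (k' + 1). repeat split; [lia|assumption|].
    eapply steps_trans; [exact Hs|].
    econstructor; [rewrite (Hjz _ _ _ _ _ _ _ (code_at_nth _ _ _ _ Hcode2))|].
    + apply Nat.eqb_neq in Hr. rewrite Hr. reflexivity.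
    + replace (l + (code_size c + 1)) with (S (l + code_size c)) by lia. constructor.
  - pose proof Hcode as Hcode0. apply code_at_app in Hcode as [Hcode1 Hcode2]. rewrite length_compile in Hcode2.
    destruct (IH1 _ _ k q0 Hcode1 Hm) as (n1 & k1 & Hk1 & Hm1 & Hs1).
    destruct (IH2 _ _ (k1 + 1) (q1 + q0) Hcode0 Hm1) as (n2 & k2 & Hk2 & Hm2 & Hs2).
    exists (n1 + (1 + n2)), k2. repeat split; [lia|assumption|].
    eapply steps_trans; [exact Hs1|].
    replace (q1 + q2 + q0) with (q2 + (q1 + q0)) by lia.
    eapply (steps_trans _ _ 1); [|exact Hs2].
    econstructor; [rewrite (Hjz _ _ _ _ _ _ _ (code_at_nth _ _ _ _ Hcode2)), Hr; reflexivity|].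
    constructor.
Qed.

Lemma run_exec O U c m m' t q : run O U c m m' t q -> bounded U m ->
  exists fuel fin, exec (compile 0 c) O fuel (Cfg 0 m 0 0) = Some fin /\
    mem fin = m' /\ nqueries fin = q /\ cost fin <= t * step_cost U.
Proof.
  intros Hr Hm.
  assert (Hcode : code_at (compile 0 c) 0 (compile 0 c)).
  { exists [], []. now rewrite app_nil_r. }
  destruct (run_steps _ _ _ _ _ _ _ Hr _ _ 0 0 Hcode Hm) as (n & k & Hk & _ & Hs).
  exists (S n). eexists. split.
  (* The machine halts by running past the last instruction. *)
  - eapply steps_exec; [exact Hs|]. unfold step. cbn [pc].
    assert (Hn : nth_error (compile 0 c) (0 + code_size c) = None).
    { apply nth_error_None. rewrite length_compile. lia. }
    rewrite Hn. reflexivity.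
  - simpl. repeat split; lia.
Qed.

(** * Total correctness with upper bounds on time and queries *)

Definition ends (O : nat -> nat) (U : nat) (c : com) (m : nat -> nat) (t q : nat)
    (Q : (nat -> nat) -> Prop) : Prop :=
  exists m' t' q', run O U c m m' t' q' /\ t' <= t /\ q' <= q /\ Q m'.

Section Rules.
Variables (O : nat -> nat) (U : nat).

Lemma ends_do i m d d' v v' t q (Q : (nat -> nat) -> Prop) :
  effect O i m = Some (d, v) -> d = d' -> v = v' -> v' <= U -> 1 <= t -> is_query i <= q ->
  Q (upd m d' v') ->
  ends O U (Do i) m t q Q.
Proof.
  intros He <- <- Hv Ht Hq HQ. exists (upd m d v), 1, (is_query i).
  repeat split; auto. now constructor.
Qed.

Lemma ends_seq c1 c2 m t1 q1 t2 q2 t q (Q : (nat -> nat) -> Prop) :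
  ends O U c1 m t1 q1 (fun m1 => ends O U c2 m1 t2 q2 Q) -> t1 + t2 <= t -> q1 + q2 <= q ->
  ends O U (Seq c1 c2) m t q Q.
Proof.
  intros (m1 & t1' & q1' & Hr1 & Ht1 & Hq1 & m2 & t2' & q2' & Hr2 & Ht2 & Hq2 & HQ) Ht Hq.
  exists m2, (t1' + t2'), (q1' + q2'). repeat split; try lia; auto. econstructor; eassumption.
Qed.

Lemma ends_weaken c m t q t' q' (Q Q' : (nat -> nat) -> Prop) :
  ends O U c m t q Q -> t <= t' -> q <= q' -> (forall m', Q m' -> Q' m') -> ends O U c m t' q' Q'.
Proof.
  intros (m1 & t1 & q1 & Hr & Ht & Hq & HQ) Htt Hqq H. exists m1, t1, q1. repeat split; try lia; auto.
Qed.

Lemma ends_when r c m t q t' (Q : (nat -> nat) -> Prop) :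
  (m r = 0 -> Q m) -> (m r <> 0 -> ends O U c m t q Q) -> S t <= t' -> ends O U (When r c) m t' q Q.
Proof.
  intros H0 H1 Ht. destruct (Nat.eq_dec (m r) 0) as [Hr|Hr].
  - exists m, 1, 0. repeat split; try lia; auto. now constructor.
  - destruct (H1 Hr) as (m1 & t1 & q1 & Hrun & Ht1 & Hq & HQ).
    exists m1, (S t1), q1. repeat split; try lia; auto. now constructor.
Qed.

(** The index of [Inv] is the loop variant: at index [j] at most [j] repetitions remain after the
    current one, which is the origin of [S j] in the bounds. *)
Lemma ends_until c r (Inv : nat -> (nat -> nat) -> Prop) t q (Q : (nat -> nat) -> Prop) :
  (forall j m, Inv j m -> ends O U c m t q (fun m' =>
     (m' r <> 0 /\ Q m') \/ (m' r = 0 /\ exists j', j = S j' /\ Inv j' m'))) ->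
  forall j m t' q', Inv j m -> S j * S t <= t' -> S j * q <= q' -> ends O U (Until c r) m t' q' Q.
Proof.
  intro Hbody. induction j as [|j IH]; intros m t' q' HI Ht Hq.
  - destruct (Hbody _ _ HI) as (m1 & t1 & q1 & Hr & Ht1 & Hq1 & [[Hf HQ]|[_ (j' & Hj & _)]]); [|discriminate].
    exists m1, (S t1), q1. repeat split; try lia; auto. now constructor.
  - destruct (Hbody _ _ HI) as (m1 & t1 & q1 & Hr & Ht1 & Hq1 & [[Hf HQ]|[Hf (j' & Hj & HI')]]).
    + exists m1, (S t1), q1. repeat split; try lia; auto. now constructor.
    + injection Hj as <-.
      destruct (IH _ (t' - S t1) (q' - q1) HI') as (m2 & t2 & q2 & Hr2 & Ht2 & Hq2 & HQ); try lia.
      exists m2, (S t1 + t2), (q1 + q2). repeat split; try nia; auto. eapply run_until_loop; eauto.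
Qed.

Fixpoint block (i : instr) (l : list instr) : com :=
  match l with
  | [] => Do i
  | j :: l' => Seq (Do i) (block j l')
  end.

Lemma ends_block_cons i j l m d d' v v' t q (Q : (nat -> nat) -> Prop) :
  effect O i m = Some (d, v) -> d = d' -> v = v' -> v' <= U -> is_query i = 0 ->
  ends O U (block j l) (upd m d' v') t q Q -> ends O U (block i (j :: l)) m (S t) q Q.
Proof.
  intros He Hd Hv HU Hq H. eapply (ends_seq _ _ _ 1 0 t q); [|lia|lia].
  eapply ends_do; eauto. lia.
Qed.

End Rules.

Lemma upd_same m i v : upd m i v i = v.
Proof. unfold upd. now rewrite Nat.eqb_refl. Qed.

Lemma upd_other m i v j : j <> i -> upd m i v j = m j.
Proof. intro H. unfold upd. apply Nat.eqb_neq in H. now rewrite H. Qed.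

Ltac lookup :=
  repeat first [ rewrite upd_same | rewrite upd_other by lia
               | match goal with H : ?m ?r = _ |- context [?m ?r] => is_var m; rewrite H end ].

Ltac frame :=
  let a := fresh "a" in let Ha := fresh "Ha" in let Hb := fresh "Hb" in
  intros a Ha Hb; simpl in Ha; lookup; reflexivity.

Ltac value_bound := first [assumption | lia | nia].

Ltac exec_one :=
  first [ eapply ends_block_cons; [reflexivity | lookup; reflexivity | lookup; reflexivity | value_bound | reflexivity |]
        | eapply ends_do; [reflexivity | lookup; reflexivity | lookup; reflexivity | value_bound | lia | simpl; lia |] ].

Ltac exec_block := repeat exec_one.

Definition same_outside (rs : list nat) (lo hi : nat) (m m' : nat -> nat) : Prop :=
  forall a, ~ In a rs -> ~ (lo <= a < hi) -> m' a = m a.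

(** * Counting loops and modular exponentiation *)

Section Loops.
Variables (O : nat -> nat) (U p e D : nat).
Hypothesis p_ge2 : 2 <= p.
Hypothesis U_large : 10 * p * p + 100 <= U.

Hypothesis e_pos : 0 < e.
Hypothesis e_lt : e < p.
Hypothesis D_pos : 0 < D.
Hypothesis D_le : D <= p.

(** With truncated subtraction [1 - (n - i)] is a loop flag: it is nonzero exactly when [i] has
    reached [n]. *)
Definition next_index : com := block (IAdd 5 5 15) [ISub 8 2 5; ISub 7 15 8].

Definition index_stable (Inv : nat -> (nat -> nat) -> Prop) : Prop :=
  forall i m m', (forall a, a <> 5 -> a <> 7 -> a <> 8 -> m' a = m a) -> Inv i m -> Inv i m'.

Lemma ends_for body n t (Inv : nat -> (nat -> nat) -> Prop) i0 m t' (Q : (nat -> nat) -> Prop) :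
  n <= p -> index_stable Inv ->
  (forall i m, i < n -> m 5 = i -> Inv i m ->
     ends O U body m t 0 (fun m' => m' 5 = i /\ m' 2 = n /\ m' 15 = 1 /\ Inv (S i) m')) ->
  i0 < n -> m 5 = i0 -> Inv i0 m -> n * (t + 4) <= t' -> (forall m', Inv n m' -> Q m') ->
  ends O U (Until (Seq body next_index) 7) m t' 0 Q.
Proof.
  intros Hn Hst Hbody Hi0 H5 HI Ht HQ.
  apply (ends_until O U _ 7 (fun j m => m 5 + S j = n /\ Inv (m 5) m) (t + 3) 0) with (j := n - S i0); try lia.
  - intros j m1 [Hj HI1].
    eapply (ends_seq _ _ _ _ _ t 0 3 0); [|lia|lia].
    eapply ends_weaken; [apply (Hbody (m1 5)); auto; lia | lia | lia |].
    intros m2 (H25 & H22 & H215 & HI2). unfold next_index. exec_block.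
    lookup. destruct (Nat.eq_dec (m1 5 + 1) n) as [He|He].
    + left. split; [lia|]. apply HQ. replace n with (S (m1 5)) by lia.
      eapply Hst; [|exact HI2]. intros a ? ? ?. now lookup.
    + right. split; [lia|]. destruct j as [|j]; [lia|]. exists j. split; [reflexivity|].
      split; [lia|]. rewrite Nat.add_1_r. eapply Hst; [|exact HI2]. intros a ? ? ?. now lookup.
  - rewrite H5. split; [lia|assumption].
  - replace (S (n - S i0)) with (n - i0) by lia. nia.
Qed.

(** Square-and-multiply: register 17 holds the remaining exponent, 18 the current square, 19 the
    accumulator, and [r19 * r18 ^ r17] is invariant modulo [p]. *)
Definition pow_step : com :=
  Seq (block (IConst 10 2) [IMod 11 17 10])
   (Seq (When 11 (block (IMul 19 19 18) [IMod 19 19 0]))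
        (block (IMul 18 18 18) [IMod 18 18 0; IDiv 17 17 10; ISub 7 15 17])).

Lemma pow_mod_l a n : (a mod p) ^ n mod p = a ^ n mod p.
Proof.
  induction n as [|n IH]; [reflexivity|]. cbn [Nat.pow].
  rewrite Nat.Div0.mul_mod, IH, Nat.Div0.mod_mod, <- Nat.Div0.mul_mod. reflexivity.
Qed.

Lemma pow_step_value r b ex :
  ((if Nat.eqb (ex mod 2) 0 then r else (r * b) mod p) * ((b * b) mod p) ^ (ex / 2)) mod p =
  (r * b ^ ex) mod p.
Proof.
  rewrite Nat.Div0.mul_mod, pow_mod_l, <- Nat.Div0.mul_mod.
  rewrite <- (Nat.pow_2_r b), <- Nat.pow_mul_r.
  pose proof (Nat.div_mod_eq ex 2) as Hd. pose proof (Nat.mod_upper_bound ex 2 ltac:(lia)) as Hm.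
  destruct (ex mod 2) as [|[|]]; [| |lia]; cbn [Nat.eqb].
  - do 3 f_equal. lia.
  - rewrite Nat.Div0.mul_mod_idemp_l. rewrite Hd at 2. rewrite Nat.pow_add_r, Nat.pow_1_r.
    f_equal. nia.
Qed.

Lemma same_outside_trans rs lo hi m1 m2 m3 :
  same_outside rs lo hi m1 m2 -> same_outside rs lo hi m2 m3 -> same_outside rs lo hi m1 m3.
Proof. intros H1 H2 a Ha Hb. rewrite H2, H1; auto. Qed.

Lemma ends_pow ex b m t (Q : (nat -> nat) -> Prop) :
  m 0 = p -> m 15 = 1 -> m 17 = ex -> 0 < ex <= p -> m 18 = b -> b < p -> m 19 = 1 ->
  (forall m', m' 19 = b ^ ex mod p -> same_outside [7; 10; 11; 17; 18; 19] 0 0 m m' -> Q m') ->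
  11 * bitlen p <= t -> ends O U (Until pow_step 7) m t 0 Q.
Proof.
  intros H0 H15 H17 Hex H18 Hb H19 HQ Ht.
  (* The variant [j] is one less than a bound on the number of binary digits left in the
     exponent. *)
  apply (ends_until O U _ 7 (fun j m1 => (0 < m1 17 < 2 ^ S j /\ m1 17 <= p) /\ m1 18 < p /\ m1 19 < p /\
    (m1 19 * m1 18 ^ m1 17) mod p = b ^ ex mod p /\
    same_outside [7; 10; 11; 17; 18; 19] 0 0 m m1) 10 0) with (j := Nat.log2 ex); [| |
      pose proof (Nat.log2_le_mono ex p ltac:(lia)); unfold bitlen in Ht; lia | lia].
  - intros j m1 ([Hx Hxp] & Hb1 & Hr1 & Hv & Hs).
    assert (H01 : m1 0 = p) by (rewrite Hs; simpl; lia).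
    assert (H151 : m1 15 = 1) by (rewrite Hs; simpl; lia).
    pose proof (pow_step_value (m1 19) (m1 18) (m1 17)) as Hstep.
    pose proof (Nat.mod_upper_bound (m1 17) 2 ltac:(lia)) as Hm2.
    eapply (ends_seq _ _ _ _ _ 2 0 8 0); [|lia|lia]. exec_block.
    eapply (ends_seq _ _ _ _ _ 3 0 5 0); [|lia|lia].
    apply (ends_weaken _ _ _ _ 3 0 3 0 (fun m2 => m2 0 = p /\ m2 15 = 1 /\ m2 10 = 2 /\
      m2 17 = m1 17 /\ m2 18 = m1 18 /\
      m2 19 = (if Nat.eqb (m1 17 mod 2) 0 then m1 19 else (m1 19 * m1 18) mod p) /\
      same_outside [7; 10; 11; 17; 18; 19] 0 0 m1 m2)); [|lia|lia|].
    { apply (ends_when _ _ _ _ _ 2); [| |lia]; lookup; intro Hbit.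
      - rewrite Hbit. lookup. repeat split. frame.
      - apply Nat.eqb_neq in Hbit. rewrite Hbit.
        pose proof (Nat.mod_upper_bound (m1 19 * m1 18) p ltac:(lia)).
        exec_block. lookup. repeat split. frame. }
    intros m2 (H02 & H152 & H102 & H172 & H182 & H192 & Hs2).
    pose proof (Nat.mod_upper_bound (m1 18 * m1 18) p ltac:(lia)).
    assert (Hdiv : m1 17 / 2 < m1 17) by (apply Nat.div_lt; lia).
    exec_block.
    assert (Hs3 : forall v1 v2 v3 v4 v5, same_outside [7; 10; 11; 17; 18; 19] 0 0 m
       (upd (upd (upd (upd (upd m2 18 v1) 18 v2) 17 v3) 17 v4) 7 v5)).
    { intros. apply (same_outside_trans _ _ _ _ m1); [assumption|].
      apply (same_outside_trans _ _ _ _ m2); [assumption|].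
      frame. }
    assert (Hr2 : (if Nat.eqb (m1 17 mod 2) 0 then m1 19 else (m1 19 * m1 18) mod p) < p).
    { destruct (Nat.eqb _ _); [assumption|]. apply Nat.mod_upper_bound. lia. }
    lookup. destruct (Nat.eq_dec (m1 17 / 2) 0) as [Hz|Hz].
    + left. split; [lia|]. apply HQ; lookup.
      * rewrite <- Hv, <- Hstep, Hz. cbn [Nat.pow]. rewrite Nat.mul_1_r.
        symmetry. apply Nat.mod_small. assumption.
      * apply (same_outside_trans _ _ _ _ m1); [assumption|].
        apply (same_outside_trans _ _ _ _ m2); [assumption|].
        frame.
    + right. split; [lia|]. destruct j as [|j].
      { cbn [Nat.pow] in Hx. assert (E : m1 17 = 1) by lia. rewrite E in Hz. now elim Hz. }
      exists j. split; [reflexivity|]. lookup.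
      assert (m1 17 / 2 < 2 ^ S j).
      { apply Nat.Div0.div_lt_upper_bound. cbn [Nat.pow] in Hx |- *. lia. }
      repeat split; try lia.
      apply (same_outside_trans _ _ _ _ m1); [assumption|].
      apply (same_outside_trans _ _ _ _ m2); [assumption|].
      frame.
  - rewrite H17, H18, H19. pose proof (Nat.log2_spec ex ltac:(lia)).
    repeat split; try lia. now rewrite Nat.mul_1_l.
Qed.

(** * The elimination algorithm *)

Definition shifted (x u : nat) : nat := (x + u) ^ e mod p.

(* Register 4 holds the current shift, 5 the loop index, 6 the write index, 7 the loop flag, 16 the
   maximal multiplicity, 20 the answer of the oracle; 8 to 11 and 17 to 19 are scratch. The remaining
   candidates start at [p + 40], the table of multiplicities at [2 * p + 40] and the values
   [shifted x u] at [3 * p + 40]. The table is all zero between two uses. *)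
Record layout (m : nat -> nat) (S : list nat) : Prop := {
  layout_p : m 0 = p;
  layout_e : m 1 = e;
  layout_n : m 2 = length S;
  layout_D : m 3 = D;
  layout_S : m 12 = p + 40;
  layout_V : m 13 = 2 * p + 40;
  layout_W : m 14 = 3 * p + 40;
  layout_one : m 15 = 1;
  layout_elements : forall i, i < length S -> m (p + 40 + i) = nth i S 0;
  layout_counts : forall v, v < p -> m (2 * p + 40 + v) = 0
}.

Lemma layout_ext m m' S : layout m S -> length S <= p ->
  (forall a, a < 4 \/ 12 <= a < 16 \/ p + 40 <= a < 3 * p + 40 -> m' a = m a) -> layout m' S.
Proof.
  intros [] Hn H. constructor; intros; rewrite H; auto; lia.
Qed.

Lemma U_linear : 10 * p + 100 <= U.
Proof. nia. Qed.

Ltac from_layout HL :=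
  let L := fresh "LU" in pose proof U_linear as L;
  let L := fresh "Lp" in pose proof (layout_p _ _ HL) as L;
  let L := fresh "Le" in pose proof (layout_e _ _ HL) as L;
  let L := fresh "Ln" in pose proof (layout_n _ _ HL) as L;
  let L := fresh "LD" in pose proof (layout_D _ _ HL) as L;
  let L := fresh "LS" in pose proof (layout_S _ _ HL) as L;
  let L := fresh "LV" in pose proof (layout_V _ _ HL) as L;
  let L := fresh "LW" in pose proof (layout_W _ _ HL) as L;
  let L := fresh "Lone" in pose proof (layout_one _ _ HL) as L.

Ltac outside H := rewrite H by (simpl; lia).

(** Register 15 holds 1, and multiplying by it stands in for a move instruction. *)
Definition compute_values : com :=
  Seq (Do (IConst 5 0))
    (Until (Seq
      (Seq (block (IAdd 8 12 5) [ILoad 18 8; IAdd 18 18 4; IMod 18 18 0; IConst 19 1; IMul 17 1 15])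
        (Seq (Until pow_step 7) (block (IAdd 8 14 5) [IStore 8 19])))
      next_index) 7).

Definition values_at (m : nat -> nat) (W : list nat) (i : nat) : Prop :=
  forall j, j < i -> m (3 * p + 40 + j) = nth j W 0.

Lemma ends_values S x m t (Q : (nat -> nat) -> Prop) :
  layout m S -> 0 < length S <= p -> (forall u, In u S -> u < p) -> m 4 = x -> x + p <= U ->
  (forall m', values_at m' (map (shifted x) S) (length S) ->
     same_outside [5; 7; 8; 10; 11; 17; 18; 19] (3 * p + 40) (4 * p + 40) m m' -> Q m') ->
  1 + length S * (11 * bitlen p + 12) <= t ->
  ends O U compute_values m t 0 Q.
Proof.
  intros HL Hn HS Hx HxU HQ Ht. from_layout HL.
  set (rs := [5; 7; 8; 10; 11; 17; 18; 19]) in *.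
  set (Inv := fun (i : nat) (m1 : nat -> nat) =>
    same_outside rs (3 * p + 40) (4 * p + 40) m m1 /\ values_at m1 (map (shifted x) S) i).
  eapply (ends_seq _ _ _ _ _ 1 0 (length S * (11 * bitlen p + 12)) 0); [|lia|lia].
  exec_block.
  apply (ends_for (Seq (block (IAdd 8 12 5) [ILoad 18 8; IAdd 18 18 4; IMod 18 18 0; IConst 19 1; IMul 17 1 15])
        (Seq (Until pow_step 7) (block (IAdd 8 14 5) [IStore 8 19]))) (length S) (11 * bitlen p + 8) Inv 0);
    [lia| | | lia | lookup; reflexivity | | lia | ].
  - intros i m1 m2 Hsame [H1 H2]. split.
    + intros a Ha Hb. unfold rs in Ha. simpl in Ha. rewrite Hsame by lia. apply H1; [simpl; lia|assumption].
    + intros j Hj. rewrite Hsame by lia. auto.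
  - intros i m1 Hi H5 [H1 H2]. unfold rs in H1.
    assert (H1_0 : m1 0 = p) by (outside H1; assumption).
    assert (H1_1 : m1 1 = e) by (outside H1; assumption).
    assert (H1_2 : m1 2 = length S) by (outside H1; assumption).
    assert (H1_4 : m1 4 = x) by (outside H1; assumption).
    assert (H1_12 : m1 12 = p + 40) by (outside H1; assumption).
    assert (H1_14 : m1 14 = 3 * p + 40) by (outside H1; assumption).
    assert (H1_15 : m1 15 = 1) by (outside H1; assumption).
    set (u := nth i S 0) in *.
    assert (Hu : u < p) by (apply HS, nth_In; lia).
    assert (HSi : m1 (p + 40 + i) = u) by (outside H1; apply (layout_elements _ _ HL); lia).
    pose proof (Nat.mod_upper_bound (u + x) p ltac:(lia)) as Hmod.
    eapply (ends_seq _ _ _ _ _ 6 0 (11 * bitlen p + 2) 0); [|lia|lia]. exec_block.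
    eapply (ends_seq _ _ _ _ _ (11 * bitlen p) 0 2 0); [|lia|lia].
    eapply (ends_pow e ((u + x) mod p)); try (lookup; lia).
    intros m2 H19 Hs.
    assert (H2_2 : m2 2 = length S) by (outside Hs; lookup; reflexivity).
    assert (H2_5 : m2 5 = i) by (outside Hs; lookup; reflexivity).
    assert (H2_14 : m2 14 = 3 * p + 40) by (outside Hs; lookup; reflexivity).
    assert (H2_15 : m2 15 = 1) by (outside Hs; lookup; reflexivity).
    assert (Hval : ((u + x) mod p) ^ e mod p = shifted x u).
    { rewrite pow_mod_l. unfold shifted. now rewrite Nat.add_comm. }
    rewrite Hval in H19.
    assert (shifted x u < p) by (apply Nat.mod_upper_bound; lia).
    exec_block. lookup. repeat split.
    + intros a Ha Hb. unfold rs in Ha. simpl in Ha. lookup. rewrite Hs by (simpl; lia). lookup.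
      apply H1; [simpl; lia|assumption].
    + intros j Hj. destruct (Nat.eq_dec j i) as [->|Hji].
      * lookup. rewrite (nth_indep _ 0 (shifted x 0)) by (rewrite length_map; lia). now rewrite map_nth.
      * lookup. rewrite Hs by (simpl; lia). lookup. apply H2. lia.
  - split; [intros a Ha _; unfold rs in Ha; simpl in Ha; lookup; reflexivity|intros j Hj; lia].
  - intros m' [H1 H2]. apply HQ; assumption.
Qed.

Lemma count_occ_firstn_S (W : list nat) i v : i < length W ->
  count_occ Nat.eq_dec (firstn (Datatypes.S i) W) v =
  count_occ Nat.eq_dec (firstn i W) v + (if Nat.eqb (nth i W 0) v then 1 else 0).
Proof.
  revert i. induction W as [|w W IH]; intros i Hi; simpl in Hi; [lia|].
  destruct i as [|i].
  - cbn [firstn nth count_occ]. destruct (Nat.eq_dec w v) as [->|Hne]; [now rewrite Nat.eqb_refl|].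
    apply Nat.eqb_neq in Hne. now rewrite Hne.
  - rewrite 2 firstn_cons. cbn [nth count_occ].
    specialize (IH i ltac:(lia)). destruct (Nat.eq_dec w v); rewrite IH; reflexivity.
Qed.

(** The last two instructions keep the running maximum, since with truncated subtraction
    [mx + (c - mx)] is [max mx c]. *)
Definition count_step : com :=
  block (IAdd 8 14 5) [ILoad 8 8; IAdd 8 8 13; ILoad 9 8; IAdd 9 9 15; IStore 8 9; ISub 10 9 16; IAdd 16 16 10].

Definition count_values : com :=
  Seq (block (IConst 16 0) [IConst 5 0]) (Until (Seq count_step next_index) 7).

(** Attainment matters as much as the bound: when the test of a shift fails, it exhibits a class
    that is really too large, so a good shift is never passed over. *)
Definition max_multiplicity (W : list nat) (mx : nat) : Prop :=
  (forall v, count_occ Nat.eq_dec W v <= mx) /\ exists v, v < p /\ count_occ Nat.eq_dec W v = mx.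

Lemma ends_count S W m t (Q : (nat -> nat) -> Prop) :
  layout m S -> 0 < length S <= p -> length W = length S -> (forall v, In v W -> v < p) ->
  values_at m W (length S) ->
  (forall m', max_multiplicity W (m' 16) ->
     (forall v, v < p -> m' (2 * p + 40 + v) = count_occ Nat.eq_dec W v) ->
     same_outside [5; 7; 8; 9; 10; 16] (2 * p + 40) (3 * p + 40) m m' -> Q m') ->
  2 + length S * 12 <= t ->
  ends O U count_values m t 0 Q.
Proof.
  intros HL Hn HW HWp Hval HQ Ht. from_layout HL.
  set (rs := [5; 7; 8; 9; 10; 16]) in *.
  set (Inv := fun (i : nat) (m1 : nat -> nat) =>
    same_outside rs (2 * p + 40) (3 * p + 40) m m1 /\
    (forall v, v < p -> m1 (2 * p + 40 + v) = count_occ Nat.eq_dec (firstn i W) v) /\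
    max_multiplicity (firstn i W) (m1 16)).
  eapply (ends_seq _ _ _ _ _ 2 0 (length S * 12) 0); [|lia|lia].
  exec_block.
  apply (ends_for count_step (length S) 8 Inv 0); [lia| | | lia | lookup; reflexivity | | lia | ].
  - intros i m1 m2 Hsame (H1 & H2 & H3). split; [|split].
    + intros a Ha Hb. unfold rs in Ha. simpl in Ha. rewrite Hsame by lia. apply H1; [simpl; lia|assumption].
    + intros v Hv. rewrite Hsame by lia. auto.
    + rewrite Hsame by lia. assumption.
  - intros i m1 Hi H5 (H1 & H2 & H3). unfold rs in H1.
    assert (H1_2 : m1 2 = length S) by (outside H1; assumption).
    assert (H1_13 : m1 13 = 2 * p + 40) by (outside H1; assumption).
    assert (H1_14 : m1 14 = 3 * p + 40) by (outside H1; assumption).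
    assert (H1_15 : m1 15 = 1) by (outside H1; assumption).
    set (w := nth i W 0) in *.
    assert (Hw : w < p) by (apply HWp, nth_In; lia).
    assert (H1W : m1 (3 * p + 40 + i) = w) by (outside H1; apply Hval; lia).
    pose proof (H2 w Hw) as Hcw. rewrite Nat.add_comm in Hcw.
    pose proof (count_occ_bound Nat.eq_dec w (firstn i W)) as Hcb. rewrite length_firstn in Hcb.
    destruct H3 as (H3 & v3 & Hv3 & H3').
    pose proof (count_occ_bound Nat.eq_dec v3 (firstn i W)) as Hcb3. rewrite length_firstn in Hcb3.
    assert (Hmx : m1 16 <= p) by lia.
    unfold count_step. exec_block. lookup. rewrite Nat.add_comm in Hcw.
    assert (Hcnt : forall v, count_occ Nat.eq_dec (firstn (Datatypes.S i) W) v =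
      count_occ Nat.eq_dec (firstn i W) v + (if Nat.eqb w v then 1 else 0))
      by (intro; apply count_occ_firstn_S; lia).
    repeat split.
    + intros a Ha Hb. unfold rs in Ha. simpl in Ha. lookup. apply H1; [simpl; lia|assumption].
    + intros v Hv. rewrite Hcnt. destruct (Nat.eqb_spec w v) as [<-|Hne].
      * rewrite (Nat.add_comm _ w). lookup. reflexivity.
      * lookup. rewrite Nat.add_0_r. auto.
    + intro v. rewrite Hcnt. specialize (H3 v). lookup.
      destruct (Nat.eqb_spec w v) as [<-|Hne]; lia.
    + destruct (le_lt_dec (count_occ Nat.eq_dec (firstn i W) w + 1) (m1 16)) as [Hle|Hlt].
      * exists v3. split; [assumption|]. rewrite Hcnt. lookup.
        destruct (Nat.eqb_spec w v3) as [E|Hne]; [rewrite E in *|]; lia.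
      * exists w. split; [assumption|]. rewrite Hcnt, Nat.eqb_refl. lookup. lia.
  - split; [|split].
    + intros a Ha _. unfold rs in Ha. simpl in Ha. lookup. reflexivity.
    + intros v Hv. lookup. apply (layout_counts _ _ HL). assumption.
    + split; [intro v; simpl; lia|]. exists 0. lookup. split; [lia|reflexivity].
  - intros m' (H1 & H2 & H3). rewrite <- HW, firstn_all in *. apply HQ; assumption.
Qed.

(** Only the entries that were incremented are reset: clearing the whole table would cost [p]
    operations instead of [|S|]. *)
Definition clear_values : com :=
  Seq (Do (IConst 5 0))
    (Until (Seq (block (IAdd 8 14 5) [ILoad 8 8; IAdd 8 8 13; IConst 9 0; IStore 8 9]) next_index) 7).

Lemma ends_clear (S W : list nat) m t (Q : (nat -> nat) -> Prop) :
  m 2 = length S -> m 13 = 2 * p + 40 -> m 14 = 3 * p + 40 -> m 15 = 1 ->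
  0 < length S <= p -> length W = length S -> (forall v, In v W -> v < p) ->
  values_at m W (length S) ->
  (forall v, v < p -> m (2 * p + 40 + v) = count_occ Nat.eq_dec W v) ->
  (forall m', (forall v, v < p -> m' (2 * p + 40 + v) = 0) ->
     same_outside [5; 7; 8; 9] (2 * p + 40) (3 * p + 40) m m' -> Q m') ->
  1 + length S * 9 <= t ->
  ends O U clear_values m t 0 Q.
Proof.
  intros Ln LV LW Lone Hn HW HWp Hval Hcnt HQ Ht. pose proof U_linear as LU.
  set (rs := [5; 7; 8; 9]) in *.
  (* Entries are never decremented but set to 0, so the invariant only says where a nonzero entry
     can still be: at a value that is yet to be visited. *)
  set (Inv := fun (i : nat) (m1 : nat -> nat) =>
    same_outside rs (2 * p + 40) (3 * p + 40) m m1 /\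
    (forall v, v < p -> m1 (2 * p + 40 + v) <> 0 -> exists j, i <= j < length S /\ nth j W 0 = v)).
  eapply (ends_seq _ _ _ _ _ 1 0 (length S * 9) 0); [|lia|lia].
  exec_block.
  apply (ends_for (block (IAdd 8 14 5) [ILoad 8 8; IAdd 8 8 13; IConst 9 0; IStore 8 9]) (length S) 5 Inv 0);
    [lia| | | lia | lookup; reflexivity | | lia | ].
  - intros i m1 m2 Hsame (H1 & H2). split.
    + intros a Ha Hb. unfold rs in Ha. simpl in Ha. rewrite Hsame by lia. apply H1; [simpl; lia|assumption].
    + intros v Hv. rewrite Hsame by lia. auto.
  - intros i m1 Hi H5 (H1 & H2). unfold rs in H1.
    assert (H1_2 : m1 2 = length S) by (outside H1; assumption).
    assert (H1_13 : m1 13 = 2 * p + 40) by (outside H1; assumption).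
    assert (H1_14 : m1 14 = 3 * p + 40) by (outside H1; assumption).
    assert (H1_15 : m1 15 = 1) by (outside H1; assumption).
    set (w := nth i W 0) in *.
    assert (Hw : w < p) by (apply HWp, nth_In; lia).
    assert (H1W : m1 (3 * p + 40 + i) = w) by (outside H1; apply Hval; lia).
    exec_block. lookup. repeat split.
    + intros a Ha Hb. unfold rs in Ha. simpl in Ha. lookup. apply H1; [simpl; lia|assumption].
    + intros v Hv. destruct (Nat.eq_dec w v) as [<-|Hne].
      * rewrite (Nat.add_comm _ w). lookup. intro H. now elim H.
      * lookup. intro H. destruct (H2 v Hv H) as (j & Hj & Hjv). exists j. split; [|assumption].
        destruct (Nat.eq_dec j i) as [->|]; [now elim Hne|lia].
  - split.
    + intros a Ha _. unfold rs in Ha. simpl in Ha. lookup. reflexivity.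
    + intros v Hv. lookup. rewrite Hcnt by assumption. intro H.
      destruct (In_nth W v 0) as (j & Hj & Hjv); [apply (count_occ_In Nat.eq_dec); lia|].
      exists j. split; [lia|assumption].
  - intros m' (H1 & H2). apply HQ; [|assumption]. intros v Hv.
    destruct (Nat.eq_dec (m' (2 * p + 40 + v)) 0) as [|Hne]; [assumption|].
    destruct (H2 v Hv Hne) as (j & Hj & _). lia.
Qed.

(* With truncated subtraction, [D - (D - (n - 1))] is [min D (n - 1)]. *)
Definition test_shift : com :=
  block (ISub 8 2 15) [ISub 9 3 8; ISub 9 3 9; IMul 9 9 16; ISub 7 2 9; ISub 8 15 7; IAdd 4 4 8].

(** For [|S| <= D] no nonempty class could be smaller than [|S| / D]. The minimum replaces the
    demand, for [|S| >= 2], by the one that all classes are singletons. *)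
Definition separates (S : list nat) (x : nat) : Prop :=
  forall v, count_occ Nat.eq_dec (map (shifted x) S) v * Nat.min D (length S - 1) < length S.

Definition search : com :=
  Seq (Do (IConst 4 0))
    (Until (Seq compute_values (Seq count_values (Seq clear_values test_shift))) 7).

Lemma shifted_lt x u : shifted x u < p.
Proof. apply Nat.mod_upper_bound. lia. Qed.

Lemma values_lt x S v : In v (map (shifted x) S) -> v < p.
Proof. intro H. apply in_map_iff in H as (u & <- & _). apply shifted_lt. Qed.

Lemma ends_search S x0 m t (Q : (nat -> nat) -> Prop) :
  layout m S -> 0 < length S <= p -> (forall u, In u S -> u < p) ->
  separates S x0 -> x0 + p <= U ->
  (forall m', layout m' S -> m' 4 <= x0 -> separates S (m' 4) ->
     values_at m' (map (shifted (m' 4)) S) (length S) -> Q m') ->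
  1 + (x0 + 1) * (length S * (11 * bitlen p + 33) + 12) <= t ->
  ends O U search m t 0 Q.
Proof.
  intros HL Hn HS Hx0 HxU HQ Ht.
  set (T := length S * (11 * bitlen p + 33) + 11).
  eapply (ends_seq _ _ _ _ _ 1 0 (Datatypes.S x0 * Datatypes.S T) 0); [|lia|lia].
  exec_block.
  apply (ends_until O U _ 7 (fun j m1 => layout m1 S /\ m1 4 + j = x0) T 0) with (j := x0); [| |lia|lia].
  2: { split; [|lookup; lia]. apply (layout_ext m); [assumption|lia|]. intros a Ha. lookup. reflexivity. }
  clear m HL. intros j m [HL Hj]. from_layout HL. set (x := m 4) in *.
  eapply (ends_seq _ _ _ _ _ (1 + length S * (11 * bitlen p + 12)) 0 (length S * 21 + 10) 0); [|unfold T; lia|lia].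
  apply (ends_values S x); try assumption; try lia.
  intros m1 Hval1 Hs1.
  assert (HL1 : layout m1 S).
  { apply (layout_ext m); [assumption|lia|]. intros a Ha. rewrite Hs1 by (simpl; lia). reflexivity. }
  assert (H1x : m1 4 = x) by (rewrite Hs1 by (simpl; lia); reflexivity).
  eapply (ends_seq _ _ _ _ _ (2 + length S * 12) 0 (length S * 9 + 8) 0); [|lia|lia].
  apply (ends_count S (map (shifted x) S)); try assumption; try lia;
    [now rewrite length_map|intro; apply values_lt|].
  intros m2 Hmax2 Hcnt2 Hs2.
  from_layout HL1.
  eapply (ends_seq _ _ _ _ _ (1 + length S * 9) 0 7 0); [|lia|lia].
  apply (ends_clear S (map (shifted x) S)); try (rewrite Hs2 by (simpl; lia); assumption); try lia;
    [now rewrite length_map|intro; apply values_lt| |assumption|].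
  { intros i Hi. rewrite Hs2 by (simpl; lia). apply Hval1. assumption. }
  intros m3 Hcnt3 Hs3.
  assert (Hs13 : forall a, a < 5 \/ 12 <= a < 16 \/ p + 40 <= a < 2 * p + 40 \/ 3 * p + 40 <= a ->
     m3 a = m1 a).
  { intros a Ha. rewrite Hs3 by (simpl; lia). apply Hs2; simpl; lia. }
  assert (HL3 : layout m3 S).
  { destruct HL1. constructor; intros; try (rewrite Hs13 by lia; auto). auto. }
  assert (H3x : m3 4 = x) by (rewrite Hs13 by lia; assumption).
  assert (H316 : m3 16 = m2 16) by (apply Hs3; simpl; lia).
  destruct Hmax2 as (Hmax & v0 & Hv0 & Hatt).
  assert (Hmx : m2 16 <= p).
  { rewrite <- Hatt. pose proof (count_occ_bound Nat.eq_dec v0 (map (shifted x) S)) as Hb.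
    rewrite length_map in Hb. lia. }
  clear Lp Le Ln LD LS LV LW Lone Lp0 Le0 Ln0 LD0 LS0 LV0 LW0 Lone0. from_layout HL3.
  assert (Hmin : D - (D - (length S - 1)) = Nat.min D (length S - 1)) by lia.
  assert (Hprod : (D - (D - (length S - 1))) * m2 16 <= U).
  { rewrite Hmin. transitivity (p * p); [apply Nat.mul_le_mono; lia|lia]. }
  unfold test_shift. exec_block. lookup. rewrite Hmin.
  set (prod := Nat.min D (length S - 1) * m2 16).
  destruct (le_lt_dec (length S) prod) as [Hle|Hlt].
  - right. split; [lia|].
    destruct j as [|j].
    { exfalso. rewrite Nat.add_0_r in Hj. specialize (Hx0 v0). rewrite <- Hj, Hatt in Hx0. unfold prod in Hle. lia. }
    exists j. split; [reflexivity|]. split; [|lia].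
    apply (layout_ext m3); [assumption|lia|]. intros a Ha. lookup. reflexivity.
  (* After a successful test the increment of register 4 is 0, so the register still holds the shift
     that was tested. *)
  - left. split; [lia|]. replace (1 - (length S - prod)) with 0 by lia. rewrite Nat.add_0_r.
    apply HQ; lookup.
    + apply (layout_ext m3); [assumption|lia|]. intros a Ha. lookup. reflexivity.
    + lia.
    + intro v. eapply Nat.le_lt_trans; [apply Nat.mul_le_mono_r, Hmax|].
      rewrite Nat.mul_comm. exact Hlt.
    + intros i Hi. lookup. rewrite Hs13 by lia. apply Hval1. assumption.
Qed.

(** The guard [1 - ((a - b) + (b - a))] is nonzero exactly when [a = b]. Survivors are compacted in
    place, which is safe because the write index never overtakes the read index. *)
Definition filter_step : com :=
  Seq (block (IAdd 8 14 5) [ILoad 8 8; ISub 9 8 20; ISub 10 20 8; IAdd 9 9 10; ISub 9 15 9])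
      (When 9 (block (IAdd 8 12 5) [ILoad 8 8; IAdd 10 12 6; IStore 10 8; IAdd 6 6 15])).

Definition query_filter : com :=
  Seq (Do (IQuery 20 4)) (Seq (block (IConst 5 0) [IConst 6 0])
    (Seq (Until (Seq filter_step next_index) 7) (Do (IMul 2 6 15)))).

Lemma filter_firstn_S (f : nat -> bool) (l : list nat) i : i < length l ->
  filter f (firstn (S i) l) = filter f (firstn i l) ++ (if f (nth i l 0) then [nth i l 0] else []).
Proof.
  revert i. induction l as [|a l IH]; intros i Hi; simpl in Hi; [lia|].
  destruct i as [|i]; [reflexivity|].
  rewrite 2 firstn_cons. cbn [nth filter]. rewrite IH by lia. destruct (f a); reflexivity.
Qed.

Lemma ends_filter S x m t (Q : (nat -> nat) -> Prop) :
  layout m S -> 0 < length S <= p -> (forall u, In u S -> u < p) -> m 4 = x -> O x < p ->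
  values_at m (map (shifted x) S) (length S) ->
  (forall m', layout m' (filter (fun u => Nat.eqb (shifted x u) (O x)) S) -> Q m') ->
  4 + length S * 16 <= t ->
  ends O U query_filter m t 1 Q.
Proof.
  intros HL Hn HS Hx HOx Hval HQ Ht. from_layout HL.
  set (f := fun u => Nat.eqb (shifted x u) (O x)) in *.
  set (rs := [5; 6; 7; 8; 9; 10; 20]) in *.
  set (Inv := fun (i : nat) (m1 : nat -> nat) =>
    same_outside rs (p + 40) (2 * p + 40) m m1 /\ m1 20 = O x /\
    m1 6 = length (filter f (firstn i S)) /\
    (forall j, j < length (filter f (firstn i S)) -> m1 (p + 40 + j) = nth j (filter f (firstn i S)) 0) /\
    (forall j, i <= j < length S -> m1 (p + 40 + j) = nth j S 0)).
  eapply (ends_seq _ _ _ _ _ 1 1 (3 + length S * 16) 0); [|lia|lia].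
  eapply ends_do; [reflexivity | reflexivity | lookup; reflexivity | lia | lia | simpl; lia |].
  eapply (ends_seq _ _ _ _ _ 2 0 (1 + length S * 16) 0); [|lia|lia]. exec_block.
  eapply (ends_seq _ _ _ _ _ (length S * 16) 0 1 0); [|lia|lia].
  apply (ends_for filter_step (length S) 12 Inv 0); [lia| | | lia | lookup; reflexivity | | lia | ].
  - intros i m1 m2 Hsame (H1 & H2 & H3 & H4 & H6). split; [|split; [|split; [|split]]].
    + intros a Ha Hb. unfold rs in Ha. simpl in Ha. rewrite Hsame by lia. apply H1; [simpl; lia|assumption].
    + rewrite Hsame by lia. assumption.
    + rewrite Hsame by lia. assumption.
    + intros j Hj. rewrite Hsame by lia. auto.
    + intros j Hj. rewrite Hsame by lia. auto.
  - intros i m1 Hi H5 (H1 & H20 & H6 & HF & Hrest). unfold rs in H1.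
    assert (H1_2 : m1 2 = length S) by (outside H1; assumption).
    assert (H1_12 : m1 12 = p + 40) by (outside H1; assumption).
    assert (H1_14 : m1 14 = 3 * p + 40) by (outside H1; assumption).
    assert (H1_15 : m1 15 = 1) by (outside H1; assumption).
    pose proof (filter_length_le f (firstn i S)) as Hlen. rewrite length_firstn in Hlen.
    pose proof (filter_firstn_S f S i Hi) as HFS.
    set (F := filter f (firstn i S)) in *.
    set (u := nth i S 0) in *.
    assert (Hu : u < p) by (apply HS, nth_In; lia).
    assert (H1W : m1 (3 * p + 40 + i) = shifted x u).
    { outside H1. rewrite Hval by lia.
      rewrite (nth_indep _ 0 (shifted x 0)) by (rewrite length_map; lia). now rewrite map_nth. }
    assert (H1S : m1 (p + 40 + i) = u) by (apply Hrest; lia).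
    pose proof (shifted_lt x u) as Hw.
    eapply (ends_seq _ _ _ _ _ 6 0 6 0); [|lia|lia]. exec_block.
    apply (ends_when _ _ _ _ _ 5); [| |lia]; lookup; intro Hbit.
    + assert (Hf : f u = false) by (apply Nat.eqb_neq; lia).
      rewrite Hf, app_nil_r in HFS. unfold Inv. rewrite HFS. lookup. repeat split.
      * intros a Ha Hb. unfold rs in Ha. simpl in Ha. lookup. apply H1; [simpl; lia|assumption].
      * intros j Hj. lookup. auto.
      * intros j Hj. lookup. apply Hrest. lia.
    + assert (Hf : f u = true) by (apply Nat.eqb_eq; lia).
      rewrite Hf in HFS. exec_block. unfold Inv. rewrite HFS. lookup. repeat split.
      * intros a Ha Hb. unfold rs in Ha. simpl in Ha. lookup. apply H1; [simpl; lia|assumption].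
      * rewrite length_app. reflexivity.
      * intros j Hj. rewrite length_app in Hj. cbn [length] in Hj. destruct (Nat.eq_dec j (length F)) as [->|Hne].
        -- lookup. rewrite app_nth2, Nat.sub_diag by lia. reflexivity.
        -- lookup. rewrite app_nth1 by lia. apply HF. lia.
      * intros j Hj. lookup. apply Hrest. lia.
  - split; [|split; [|split; [|split]]].
    + intros a Ha _. unfold rs in Ha. simpl in Ha. lookup. reflexivity.
    + lookup. reflexivity.
    + lookup. reflexivity.
    + intros j Hj. simpl in Hj. lia.
    + intros j Hj. lookup. apply (layout_elements _ _ HL). lia.
  - intros m' (H1 & _ & H6 & HF & _). rewrite firstn_all in *. unfold rs in H1.
    pose proof (filter_length_le f S) as Hlen.
    assert (H15 : m' 15 = 1) by (outside H1; assumption).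
    exec_block. apply HQ. constructor; lookup; try (outside H1; assumption); try reflexivity.
    + apply Nat.mul_1_r.
    + intros i Hi. lookup. auto.
    + intros v Hv. lookup. outside H1. apply (layout_counts _ _ HL). assumption.
Qed.

(** * Rounds of elimination *)

Section Elimination.
Variable s : nat.
Hypothesis oracle_spec : forall x, O x = shifted x s.
Variable S0 : list nat.
Hypothesis S0_lt : forall u, In u S0 -> u < p.
Hypothesis S0_len : length S0 <= e.

Record candidates (S : list nat) : Prop := {
  candidates_s : In s S;
  candidates_nodup : NoDup S;
  candidates_incl : forall u, In u S -> In u S0;
  candidates_len : length S <= length S0
}.

Lemma candidates_pos S : candidates S -> 0 < length S <= p.
Proof.
  intros [Hs _ _ Hl]. split; [destruct S; [contradiction|simpl; lia]|lia].
Qed.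

Lemma candidates_lt S u : candidates S -> In u S -> u < p.
Proof. intros [_ _ Hi _] Hu. auto. Qed.

Lemma candidates_filter S x : candidates S -> candidates (filter (fun u => Nat.eqb (shifted x u) (O x)) S).
Proof.
  intros [Hs Hn Hi Hl]. constructor.
  - apply filter_In. split; [assumption|]. rewrite oracle_spec. apply Nat.eqb_refl.
  - now apply NoDup_filter.
  - intros u Hu. apply filter_In in Hu as [Hu _]. auto.
  - pose proof (filter_length_le (fun u => Nat.eqb (shifted x u) (O x)) S). lia.
Qed.

Lemma oracle_lt x : O x < p.
Proof. rewrite oracle_spec. apply shifted_lt. Qed.

(** The number of these questions is a constant of the program, so the loop is unrolled; the base
    case is a harmless placeholder. *)
Fixpoint ask_shifts (k : nat) : com :=
  match k with
  | 0 => Do (IConst 4 0)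
  | S k => Seq (ask_shifts k) (Seq (Do (IConst 4 k)) (Seq compute_values query_filter))
  end.

Lemma ends_ask_shifts k m S t q (Q : (nat -> nat) -> Prop) :
  layout m S -> candidates S -> k + p <= U ->
  (forall m' S', layout m' S' -> candidates S' ->
     (forall i u, i < k -> In u S' -> shifted i u = shifted i s) -> Q m') ->
  1 + k * (length S0 * (11 * bitlen p + 28) + 6) <= t -> k <= q ->
  ends O U (ask_shifts k) m t q Q.
Proof.
  revert t q Q. induction k as [|k IH]; intros t q Q HL HC HU HQ Ht Hq; cbn [ask_shifts].
  - exec_block. apply (HQ _ S); [|assumption|intros; lia].
    apply (layout_ext m); [assumption|apply candidates_pos in HC; lia|]. intros a Ha. lookup. reflexivity.
  - set (T := length S0 * (11 * bitlen p + 28) + 6) in *.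
    eapply (ends_seq _ _ _ _ _ (1 + k * T) k T 1); [|lia|lia].
    apply IH; try assumption; try lia. clear IH m S HL HC. intros m S HL HC Hagree.
    pose proof (candidates_pos S HC) as Hpos.
    pose proof (candidates_len S HC) as Hlen.
    assert (HT : 1 + ((1 + length S * (11 * bitlen p + 12)) + (4 + length S * 16)) <= T).
    { unfold T. pose proof (Nat.mul_le_mono_r _ _ (11 * bitlen p + 28) Hlen). lia. }
    eapply (ends_seq _ _ _ _ _ 1 0 (T - 1) 1); [|lia|lia]. exec_block.
    eapply (ends_seq _ _ _ _ _ (1 + length S * (11 * bitlen p + 12)) 0 (4 + length S * 16) 1); [|lia|lia].
    assert (HL1 : layout (upd m 4 k) S).
    { apply (layout_ext m); [assumption|lia|]. intros a Ha. lookup. reflexivity. }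
    apply (ends_values S k); try assumption; try lia; [intros; eapply candidates_lt; eassumption|lookup; reflexivity|].
    intros m1 Hval Hs.
    apply (ends_filter S k); try lia.
    + apply (layout_ext (upd m 4 k)); [assumption|lia|]. intros a Ha. apply Hs; simpl; lia.
    + intros; eapply candidates_lt; eassumption.
    + rewrite Hs by (simpl; lia). lookup. reflexivity.
    + apply oracle_lt.
    + assumption.
    + intros m2 HL2. apply (HQ _ _ HL2); [now apply candidates_filter|].
      intros i u Hi Hu. apply filter_In in Hu as [Hu Hf]. apply Nat.eqb_eq in Hf.
      destruct (Nat.eq_dec i k) as [->|]; [now rewrite Hf, oracle_spec|]. apply Hagree; [lia|assumption].
Qed.

Definition eliminate : com :=
  Seq (Do (ISub 7 2 15))
    (When 7 (Until (Seq search (Seq query_filter (block (ISub 8 2 15) [ISub 7 15 8]))) 7)).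

Lemma length_filter_count x S :
  length (filter (fun u => Nat.eqb (shifted x u) (O x)) S) =
  count_occ Nat.eq_dec (map (shifted x) S) (O x).
Proof.
  induction S as [|u S IH]; [reflexivity|]. cbn [filter map count_occ].
  destruct (Nat.eq_dec (shifted x u) (O x)) as [E|E].
  - rewrite E, Nat.eqb_refl. cbn [length]. now rewrite IH.
  - apply Nat.eqb_neq in E. now rewrite E.
Qed.

(** [P] will be agreement on the first [k] shifts, which filtering preserves. Up to logarithmic
    factors [w] bounds the cost of one search, and [R + 1] bounds the number of rounds. *)
Variables (P : list nat -> Prop) (w R : nat).
Hypothesis P_sub : forall S x, P S -> P (filter (fun u => Nat.eqb (shifted x u) (O x)) S).
Hypothesis P_separates : forall S, candidates S -> P S -> 1 < length S ->
  exists x, separates S x /\ length S * (x + 1) <= w /\ x + p <= U.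
Hypothesis rounds_bound : forall r, 2 * D ^ r <= e -> r + 2 <= e -> r <= R.

Lemma ends_eliminate m S t q (Q : (nat -> nat) -> Prop) :
  layout m S -> candidates S -> P S ->
  (forall m', layout m' [s] -> Q m') ->
  2 + (R + 1) * (w * (11 * bitlen p + 61) + 8) <= t -> R + 1 <= q ->
  ends O U eliminate m t q Q.
Proof.
  intros HL HC HP HQ Ht Hq.
  assert (Hsingle : forall S', candidates S' -> length S' <= 1 -> S' = [s]).
  { intros S' [Hs _ _ _] Hl. destruct S' as [|a [|]]; simpl in *; [contradiction| |lia].
    destruct Hs as [->|[]]. reflexivity. }
  set (T := w * (11 * bitlen p + 61) + 7) in *.
  pose proof (candidates_pos S HC) as Hpos. pose proof (candidates_len S HC) as Hlen.
  from_layout HL.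
  eapply (ends_seq _ _ _ _ _ 1 0 (t - 1) q); [|lia|lia]. exec_block.
  assert (HL1 : forall v, layout (upd m 7 v) S).
  { intro. apply (layout_ext m); [assumption|lia|]. intros a Ha. lookup. reflexivity. }
  apply (ends_when _ _ _ _ _ (t - 2)); [| |lia]; lookup; intro Hflag.
  { apply HQ. rewrite <- (Hsingle S HC) by lia. apply HL1. }
  (* For [D >= 2] the inequality [|S1| * D ^ r <= e] limits the number [r] of rounds. For [D = 1] it
     says nothing about [r], and the strict decrease recorded in [|S1| + r <= e] takes over. *)
  apply (ends_until O U _ 7 (fun j m1 => exists S1 r, layout m1 S1 /\ candidates S1 /\ P S1 /\
    1 < length S1 /\ r + j = R /\ length S1 * D ^ r <= e /\ length S1 + r <= e) T 1) with (j := R); [| |lia|lia].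
  2: { exists S, 0. cbn [Nat.pow]. repeat split; auto; try apply HL1; try apply HC; lia. }
  clear m S HL HC HP Hpos Hlen Lp Le Ln LD LS LV LW Lone LU HL1 Hflag.
  intros j m (S & r & HL & HC & HP & Hlt & Hr & HDr & Hnr).
  pose proof (candidates_pos S HC) as Hpos.
  destruct (P_separates S HC HP Hlt) as (x0 & Hsep & Hw & HxU).
  assert (HT : (1 + (x0 + 1) * (length S * (11 * bitlen p + 33) + 12)) + (4 + length S * 16) + 2 <= T).
  { unfold T.
    assert ((x0 + 1) * (length S * (11 * bitlen p + 33) + 12) <= w * (11 * bitlen p + 45)).
    { transitivity ((length S * (x0 + 1)) * (11 * bitlen p + 45)).
      { pose proof (Nat.mul_le_mono_r 1 (length S) (x0 + 1) ltac:(lia)). lia. } apply Nat.mul_le_mono_r. assumption. }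
    assert (length S <= w) by nia. lia. }
  eapply (ends_seq _ _ _ _ _ (1 + (x0 + 1) * (length S * (11 * bitlen p + 33) + 12)) 0 (6 + length S * 16) 1); [|lia|lia].
  apply (ends_search S x0); try assumption; try lia; [intros; eapply candidates_lt; eassumption|].
  intros m1 HL1 Hx1 Hsep1 Hval1. set (x := m1 4) in *.
  eapply (ends_seq _ _ _ _ _ (4 + length S * 16) 1 2 0); [|lia|lia].
  apply (ends_filter S x); try assumption; try lia; [intros; eapply candidates_lt; eassumption|apply oracle_lt|].
  intros m2 HL2. set (S2 := filter _ S) in *.
  assert (HC2 : candidates S2) by now apply candidates_filter.
  assert (HP2 : P S2) by now apply P_sub.
  pose proof (candidates_pos S2 HC2) as Hpos2.
  assert (Hn2 : length S2 * Nat.min D (length S - 1) < length S).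
  { unfold S2. rewrite length_filter_count. apply Hsep1. }
  from_layout HL2. exec_block. lookup.
  assert (HL3 : forall v v', layout (upd (upd m2 8 v) 7 v') S2).
  { intros. apply (layout_ext m2); [assumption|lia|]. intros a Ha. lookup. reflexivity. }
  destruct (le_lt_dec (length S2) 1) as [Hle|Hgt].
  - left. split; [lia|]. apply HQ. rewrite <- (Hsingle S2 HC2) by lia. apply HL3.
  - right. split; [lia|].
    (* If the minimum in [separates] were [|S| - 1], a single candidate would be left and the loop
       would have ended. *)
    assert (HDn : D <= length S - 1).
    { destruct (le_lt_dec D (length S - 1)) as [|HDn]; [assumption|].
      rewrite Nat.min_r in Hn2 by lia.
      pose proof (Nat.mul_le_mono_r 2 (length S2) (length S - 1) ltac:(lia)). lia. }
    rewrite Nat.min_l in Hn2 by assumption.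
    assert (Hdrop : length S2 < length S).
    { pose proof (Nat.mul_le_mono_l 1 D (length S2) D_pos). lia. }
    assert (HDr2 : length S2 * D ^ Datatypes.S r <= e).
    { cbn [Nat.pow]. rewrite Nat.mul_assoc. transitivity (length S * D ^ r); [|assumption].
      apply Nat.mul_le_mono_r. lia. }
    assert (Hr2 : Datatypes.S r <= R).
    { apply rounds_bound; [|lia]. transitivity (length S2 * D ^ Datatypes.S r); [|assumption].
      apply Nat.mul_le_mono_r. lia. }
    exists (R - Datatypes.S r). split; [lia|]. exists S2, (Datatypes.S r).
    repeat split; try apply HL3; try apply HC2; auto; try lia.
Qed.

End Elimination.

End Loops.

(** * Relocation of the input and computation of [D] *)

Section Setup.
Variables (O : nat -> nat) (U p e : nat).
Hypothesis p_ge2 : 2 <= p.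
Hypothesis U_large : 10 * p * p + 100 <= U.
Hypothesis e_pos : 0 < e.
Hypothesis e_lt : e < p.

(** The first 37 elements occupy registers 3 to 39, which are to become work registers. The source
    registers are literals, so one free register, for the target address, is enough. *)
Fixpoint save_registers (n : nat) : com :=
  match n with
  | 0 => Do (IConst 2 0)
  | S n => Seq (save_registers n) (block (IConst 2 (40 + n)) [IAdd 2 2 0; IStore 2 (3 + n)])
  end.

Lemma ends_save_registers n m t (Q : (nat -> nat) -> Prop) :
  n <= 37 -> m 0 = p -> (forall j, j < n -> m (3 + j) <= p) ->
  (forall m', (forall a, a <> 2 -> ~ (p + 40 <= a < p + 40 + n) -> m' a = m a) ->
     (forall j, j < n -> m' (p + 40 + j) = m (3 + j)) -> Q m') ->
  1 + 3 * n <= t -> ends O U (save_registers n) m t 0 Q.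
Proof.
  assert (LU : 10 * p + 100 <= U) by nia.
  revert t Q. induction n as [|n IH]; intros t Q Hn H0 Hm HQ Ht; cbn [save_registers].
  - exec_block. apply HQ; intros; [lookup; reflexivity|lia].
  - eapply (ends_seq _ _ _ _ _ (1 + 3 * n) 0 3 0); [|lia|lia].
    apply IH; [lia|assumption|intros; apply Hm; lia| |lia].
    intros m1 H1 H2.
    assert (H1_0 : m1 0 = p) by (rewrite H1 by lia; assumption).
    assert (H1_n : m1 (3 + n) <= p) by (rewrite H1 by lia; apply Hm; lia).
    exec_block. rewrite (Nat.add_comm _ p), Nat.add_assoc. apply HQ.
    + intros a Ha Hb. lookup. apply H1; [assumption|lia].
    + intros j Hj. destruct (Nat.eq_dec j n) as [->|Hne].
      * lookup. apply H1; lia.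
      * lookup. apply H2. lia.
Qed.

(* The input fills the registers from 3 on, so only 0, 1 and 2 are free at first. Packing [e] and
   [n = length S] into register 1 as [e * p + n] frees register 2 for the target address of the copies. *)
Definition relocate : com :=
  Seq (block (IMul 1 1 0) [IAdd 1 1 2])
  (Seq (save_registers 37)
  (Seq (block (IMod 2 1 0) [IDiv 1 1 0; IConst 15 1; IConst 5 37; ISub 7 2 5])
  (Seq (When 7 (Until (Seq (block (IConst 8 3)
          [IAdd 8 8 5; ILoad 9 8; IConst 8 40; IAdd 8 8 0; IAdd 8 8 5; IStore 8 9]) next_index) 7))
       (block (IConst 12 40) [IAdd 12 12 0; IAdd 13 12 0; IAdd 14 13 0])))).

Lemma ends_relocate S m t (Q : (nat -> nat) -> Prop) :
  length S <= e -> (forall u, In u S -> u < p) -> (forall i, m i = mem (init_cfg p e S) i) ->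
  (forall m', layout p e (m' 3) m' S -> Q m') ->
  124 + e * 11 <= t -> ends O U relocate m t 0 Q.
Proof.
  intros Hn HS Hm HQ Ht. assert (LU : 10 * p + 100 <= U) by nia.
  assert (H0 : m 0 = p) by now rewrite Hm.
  assert (H1 : m 1 = e) by now rewrite Hm.
  assert (H2 : m 2 = length S) by now rewrite Hm.
  assert (H3 : forall j, m (3 + j) = nth j S 0) by (intro; now rewrite Hm).
  assert (Hnth : forall j, nth j S 0 < p).
  { intro j. destruct (Nat.lt_ge_cases j (length S)); [now apply HS, nth_In|rewrite nth_overflow; lia]. }
  assert (He : e * p + length S <= p * p) by nia.
  assert (Hee : e * p <= p * p) by nia.
  eapply (ends_seq _ _ _ _ _ 2 0 (122 + e * 11) 0); [|lia|lia]. exec_block.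
  eapply (ends_seq _ _ _ _ _ 112 0 (10 + e * 11) 0); [|lia|lia].
  apply ends_save_registers; [lia|lookup; reflexivity| | |lia].
  { intros j Hj. lookup. rewrite H3. specialize (Hnth j). lia. }
  intros m1 Hs Hsaved.
  assert (Hs' : forall a, 3 <= a -> ~ (p + 40 <= a < p + 77) -> m1 a = m a).
  { intros a Ha Hb. rewrite Hs by lia. lookup. reflexivity. }
  assert (Hsaved' : forall j, j < 37 -> m1 (p + 40 + j) = nth j S 0).
  { intros j Hj. rewrite Hsaved by assumption. lookup. apply H3. }
  assert (H1_0 : m1 0 = p) by (rewrite Hs by lia; lookup; reflexivity).
  assert (H1_1 : m1 1 = e * p + length S) by (rewrite Hs by lia; lookup; reflexivity).
  clear Hs Hsaved.
  (* For small [p] the 37 copies reach into the table of multiplicities, but there they lie beyond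
     the end of the list and are zeros. *)
  assert (HV : forall v, v < p -> m1 (2 * p + 40 + v) = 0).
  { intros v Hv. destruct (le_lt_dec 37 (p + v)) as [Hle|Hlt].
    - rewrite Hs' by lia. replace (2 * p + 40 + v) with (3 + (2 * p + 37 + v)) by lia.
      rewrite H3. apply nth_overflow. lia.
    - replace (2 * p + 40 + v) with (p + 40 + (p + v)) by lia. rewrite Hsaved' by lia.
      apply nth_overflow. lia. }
  assert (Hmod : (e * p + length S) mod p = length S).
  { rewrite Nat.add_comm, Nat.Div0.mod_add. apply Nat.mod_small. lia. }
  assert (Hdiv : (e * p + length S) / p = e).
  { rewrite Nat.add_comm, Nat.div_add by lia. rewrite Nat.div_small; lia. }
  eapply (ends_seq _ _ _ _ _ 5 0 (5 + e * 11) 0); [|lia|lia].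
  eapply ends_block_cons; [reflexivity | reflexivity | lookup; exact Hmod | lia | reflexivity |].
  eapply ends_block_cons; [reflexivity | reflexivity | lookup; exact Hdiv | lia | reflexivity |].
  exec_block.
  eapply (ends_seq _ _ _ _ _ (1 + e * 11) 0 4 0); [|lia|lia].
  set (Inv := fun (i : nat) (m1 : nat -> nat) => m1 0 = p /\ m1 1 = e /\ m1 2 = length S /\ m1 15 = 1 /\ 37 <= i /\
    (forall j, j < i -> j < length S -> m1 (p + 40 + j) = nth j S 0) /\
    (forall j, i <= j < length S -> 37 <= j -> m1 (3 + j) = nth j S 0) /\
    (forall v, v < p -> m1 (2 * p + 40 + v) = 0)).
  apply (ends_weaken _ _ _ _ (1 + e * 11) 0 _ 0 (fun m2 => exists i, length S <= i /\ Inv i m2)); [|lia|lia|].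
  - apply (ends_when _ _ _ _ _ (e * 11)); [| |lia]; lookup; intro Hflag.
    + exists 37. split; [lia|]. repeat split; lookup; try reflexivity.
      * intros j _ Hj. lookup. apply Hsaved'. lia.
      * intros j Hj. lia.
      * intros v Hv. lookup. auto.
    + apply (ends_for O U p e 1 p_ge2 U_large e_pos e_lt (le_n 1) (Nat.lt_le_incl _ _ p_ge2) (block (IConst 8 3)
          [IAdd 8 8 5; ILoad 9 8; IConst 8 40; IAdd 8 8 0; IAdd 8 8 5; IStore 8 9]) (length S) 7 Inv 37);
        [lia| | | lia | lookup; reflexivity | | nia | intros m2 HI; exists (length S); split; [lia|exact HI] ].
      * intros i m2 m3 Hsame (A0 & A1 & A2 & A15 & Ai & A3 & A4 & A5). unfold Inv.
        repeat split; intros; try (rewrite Hsame by lia); auto.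
      * intros i m2 Hi H5 (A0 & A1 & A2 & A15 & Ai & A3 & A4 & A5).
        pose proof (Hnth i) as Hu. pose proof (A4 i ltac:(lia) Ai) as Hv. set (u := nth i S 0) in *.
        exec_block. rewrite (Nat.add_comm 40 p). unfold Inv. repeat split; lookup; auto; try lia.
        -- intros j Hj Hjn. destruct (Nat.eq_dec j i) as [->|Hne]; lookup; [reflexivity|]. apply A3; lia.
        -- intros j Hj H37. lookup. apply A4; lia.
        -- intros v Hv'. lookup. auto.
      * unfold Inv. repeat split; lookup; try reflexivity.
        -- intros j Hj Hjn. lookup. apply Hsaved'. lia.
        -- intros j Hj H37. lookup. rewrite Hs' by lia. apply H3.
        -- intros v Hv. lookup. auto.
  - intros m2 (i & Hi & A0 & A1 & A2 & A15 & _ & A3 & A4 & A5). exec_block. apply HQ. constructor; lookup; try reflexivity.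
    + lia.
    + lia.
    + lia.
    + intros j Hj. lookup. apply A3; lia.
    + intros v Hv. lookup. auto.
Qed.

Fixpoint power_into (K : nat) : com :=
  match K with
  | 0 => Do (IConst 9 1)
  | S K => Seq (power_into K) (Do (IMul 9 9 8))
  end.

Lemma ends_power_into K m t (Q : (nat -> nat) -> Prop) :
  1 <= m 8 -> m 8 ^ K <= U ->
  (forall m', m' 9 = m 8 ^ K -> (forall a, a <> 9 -> m' a = m a) -> Q m') ->
  K + 1 <= t -> ends O U (power_into K) m t 0 Q.
Proof.
  revert t Q. induction K as [|K IH]; intros t Q H8 HU HQ Ht; cbn [power_into].
  - eapply ends_do; [reflexivity | reflexivity | reflexivity | simpl in HU; lia | lia | simpl; lia |].
    apply HQ; [now lookup|]. intros a Ha. lookup. reflexivity.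
  - assert (Hle : m 8 ^ K <= m 8 ^ S K) by (apply Nat.pow_le_mono_r; lia).
    eapply (ends_seq _ _ _ _ _ (K + 1) 0 1 0); [|lia|lia].
    apply IH; [assumption|lia| |lia]. intros m1 H9 Hs.
    assert (E : m1 8 = m 8) by (apply Hs; lia).
    eapply ends_do; [reflexivity | reflexivity | rewrite H9, E; apply Nat.mul_comm | exact HU | lia | simpl; lia |].
    apply HQ; [now lookup|]. intros a Ha. lookup. now apply Hs.
Qed.

Variables (c K : nat).
Hypothesis c_pos : 0 < c.
Hypothesis K_pos : 0 < K.
Hypothesis U_power : (2 * c) ^ K * p <= U.

(** This finds the least [D >= 1] with [e < (c * (D + 1)) ^ K]. A linear search is affordable, as it
    takes at most [e] trials. If already [D = 1] passes, nothing is known about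
    [(c * D) ^ K <= e]. *)
Definition compute_scale : com :=
  Seq (Do (IConst 3 0))
    (Until (Seq (block (IAdd 3 3 15) [IConst 8 c; IAdd 9 3 15; IMul 8 8 9])
      (Seq (power_into K) (Do (ISub 7 9 1)))) 7).

Lemma ends_compute_scale S m t (Q : (nat -> nat) -> Prop) :
  layout p e (m 3) m S -> length S <= p ->
  (forall D m', 0 < D -> D <= e -> e < (c * (D + 1)) ^ K -> D = 1 \/ (c * D) ^ K <= e ->
     layout p e D m' S -> Q m') ->
  1 + (e + 1) * (K + 8) <= t -> ends O U compute_scale m t 0 Q.
Proof.
  intros HL Hn HQ Ht. assert (LU : 10 * p + 100 <= U) by nia.
  assert (Hpow : forall x, 0 < x -> x <= x ^ K).
  { intros x Hx. rewrite <- (Nat.pow_1_r x) at 1. apply Nat.pow_le_mono_r; lia. }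
  assert (Hc : 2 * c <= U).
  { pose proof (Hpow (2 * c) ltac:(lia)). nia. }
  eapply (ends_seq _ _ _ _ _ 1 0 ((e + 1) * (K + 8)) 0); [|lia|lia]. exec_block.
  apply (ends_until O U _ 7 (fun j m1 => layout p e (m1 3) m1 S /\ m1 3 + j = e /\
     (m1 3 = 0 \/ (c * (m1 3 + 1)) ^ K <= e)) (K + 6) 0) with (j := e); [| |nia|lia].
  - clear m HL. intros j m (HL & Hj & HD). set (d := m 3) in *.
    pose proof (layout_e _ _ _ _ _ HL) as Le. pose proof (layout_one _ _ _ _ _ HL) as Lone.
    set (x := c * (d + 1 + 1)).
    (* The previous power was at most [e] and the base at most doubles from one trial to the next,
       so even the failing power exceeds [e] by a constant factor only; this keeps it below [U]. *)
    assert (Hx : x ^ K <= (2 * c) ^ K * e).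
    { destruct HD as [Hd|Hd].
      - unfold x. rewrite Hd. replace (c * (0 + 1 + 1)) with (2 * c) by lia. nia.
      - transitivity ((2 * (c * (d + 1))) ^ K).
        + apply Nat.pow_le_mono_l. unfold x. nia.
        + rewrite Nat.pow_mul_l. apply Nat.mul_le_mono; [|assumption].
          apply Nat.pow_le_mono_l. lia. }
    assert (Hx0 : 0 < x) by (apply Nat.mul_pos_pos; lia).
    assert (HxU : x ^ K <= U).
    { transitivity ((2 * c) ^ K * p); [|assumption]. etransitivity; [exact Hx|]. apply Nat.mul_le_mono_l. lia. }
    assert (Hcd : forall y, y <= c * y) by (intro y; pose proof (Nat.mul_le_mono_r 1 c y c_pos); lia).
    assert (HxU1 : x <= U) by (pose proof (Hpow x Hx0); lia).
    eapply (ends_seq _ _ _ _ _ 4 0 (K + 2) 0); [|lia|lia].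
    assert (Hd : m 3 = d) by reflexivity.
    exec_block. fold x.
    eapply (ends_seq _ _ _ _ _ (K + 1) 0 1 0); [|lia|lia].
    apply ends_power_into; lookup; [lia|assumption| |lia].
    intros m1 H9 Hs.
    assert (H1_1 : m1 1 = e) by (rewrite Hs by lia; lookup; reflexivity).
    assert (H1_3 : m1 3 = d + 1) by (rewrite Hs by lia; lookup; reflexivity).
    exec_block. lookup.
    assert (HL2 : forall v, layout p e (d + 1) (upd m1 7 v) S).
    { intro v. destruct HL. constructor; intros; lookup; try reflexivity;
        try (rewrite Hs by lia; lookup; auto; reflexivity). }
    destruct (le_lt_dec (x ^ K) e) as [Hle|Hlt].
    + right. split; [lia|].
      assert (d + 1 + 1 <= x) by apply Hcd. pose proof (Hpow x Hx0).
      exists (e - (d + 1)). repeat split; try apply HL2; try lia. right. exact Hle.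
    + left. split; [lia|]. apply (HQ (d + 1)).
      * lia.
      * destruct HD as [->|HD]; [lia|]. pose proof (Hcd (d + 1)). pose proof (Hpow (c * (d + 1)) ltac:(lia)). lia.
      * exact Hlt.
      * destruct HD as [->|HD]; [left; reflexivity|right; exact HD].
      * apply HL2.
  - split; [|split; [lookup; lia|left; lookup; reflexivity]].
    lookup. destruct HL. constructor; intros; lookup; auto; reflexivity.
Qed.

End Setup.

(** * Separation of the candidates *)

Module Separation.

Import mathcomp.boot.all_boot mathcomp.order.all_order mathcomp.algebra.all_algebra.
Import mathcomp.fingroup.perm mathcomp.zify.zify mathcomp.algebra_tactics.ring.
Set Implicit Arguments.
Unset Strict Implicit.
Unset Printing Implicit Defensive.
Import GRing.Theory.
Local Open Scope ring_scope.

(** * Orders of vanishing and the Euler operator *)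

Section Multiplicity.
Variable F : fieldType.
Implicit Types (f g : {poly F}) (z : F).

Lemma sum_mult_lt_size (I : eqType) (r : seq I) (z : I -> F) (m : I -> nat) f :
  f != 0 -> uniq r -> {in r &, injective z} ->
  {in r, forall i, ('X - (z i)%:P) ^+ m i %| f} ->
  (\sum_(i <- r) m i < size f)%N.
Proof.
move=> f0 ur zinj dvd; have co (P : {poly F}) : (\prod_(i <- r) ('X - (z i)%:P) ^+ m i) %| f.
  elim: r ur zinj dvd => [|i r IH] /=; first by rewrite big_nil dvd1p.
  move=> /andP[ir ur] zinj dvd; rewrite big_cons Gauss_dvdp.
    rewrite dvd ?mem_head //= IH // => [x y xr yr|x xr]; last by apply: dvd; rewrite inE xr orbT.
    by apply: zinj; rewrite inE ?xr ?yr orbT.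
  rewrite big_seq; elim/big_rec: _ => [|j g jr co]; first exact: coprimep1.
  rewrite coprimepMr co andbT; apply/coprimep_expl/coprimep_expr.
  rewrite coprimep_XsubC root_XsubC; apply: contra ir => /eqP zij.
  by rewrite (zinj i j) ?inE ?eqxx ?jr ?orbT // zij.
have := dvdp_leq f0 (co 0); apply: leq_trans.
rewrite size_prod_seq; last by move=> i _; rewrite expf_neq0 // polyXsubC_eq0.
rewrite [X in (_ <= X.+1 - _)%N](eq_bigr (fun i => (m i).+1)) => [|i _]; last exact: size_exp_XsubC.
elim: {ur zinj dvd co} r => [|i r IH]; first by rewrite !big_nil.
by rewrite !big_cons /=; lia.
Qed.

(** The Euler operator is used instead of the derivative because it is diagonal on monomials, with
    eigenvalue the degree: it never raises degrees, and leading terms of Wronskians become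
    Vandermonde determinants. *)
Definition xderiv f := 'X * f^`().

Lemma coef_xderiv_iter r f d : (iter r xderiv f)`_d = d%:R ^+ r * f`_d.
Proof.
elim: r => [|r IH] /=; first by rewrite mul1r.
rewrite /xderiv coefXM coef_deriv; case: d IH => [|d] IH /=; first by rewrite exprS !mul0r.
by rewrite IH exprS -mulrA [RHS]mulr_natl.
Qed.

Lemma size_xderiv_iter r f : (size (iter r xderiv f) <= size f)%N.
Proof. by apply/leq_sizeP => j /leq_sizeP /(_ j (leqnn j)) fj; rewrite coef_xderiv_iter fj mulr0. Qed.

Lemma dvdp_xderiv z m f : ('X - z%:P) ^+ m %| f -> ('X - z%:P) ^+ m.-1 %| xderiv f.
Proof.
case/dvdpP=> q ->; rewrite /xderiv derivM deriv_exp derivXsubC mul1r.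
apply: dvdp_mull; apply: dvdp_add; apply: dvdp_mull; last by rewrite -mulr_natl dvdp_mull.
by apply: dvdp_exp2l; apply: leq_pred.
Qed.

Lemma dvdp_xderiv_iter z m r f :
  ('X - z%:P) ^+ m %| f -> ('X - z%:P) ^+ (m - r) %| iter r xderiv f.
Proof. by elim: r => [|r IH] d; rewrite ?subn0 // subnS /=; apply/dvdp_xderiv/IH. Qed.

(** The [d i] are only degree bounds, so this applies to every product in the expansion of a
    determinant, even where an entry has lost its leading term. *)
Lemma coef_prod_top (I : Type) (r : seq I) (g : I -> {poly F}) (d : I -> nat) :
  (forall i, (size (g i) <= (d i).+1)%N) ->
  (\prod_(i <- r) g i)`_(\sum_(i <- r) d i) = \prod_(i <- r) (g i)`_(d i)
  /\ (size (\prod_(i <- r) g i)%R <= (\sum_(i <- r) d i).+1)%N.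
Proof.
move=> sz; elim: r => [|i r [IH1 IH2]]; first by rewrite !big_nil coef1 size_poly1.
rewrite !big_cons; split; last first.
  by apply: leq_trans (size_polyMleq _ _) _; have := sz i; lia.
rewrite coefM -IH1.
have lt_d : (d i < (d i + \sum_(j <- r) d j).+1)%N by lia.
rewrite (bigD1 (Ordinal lt_d)) //= addKn [X in _ + X]big1 ?addr0 // => -[j Hj] /=.
rewrite -val_eqE /= => jd; case: (ltngtP j (d i)) jd => // jd _.
- by rewrite [X in _ * X](nth_default 0) ?mulr0 //; apply: leq_trans IH2 _; lia.
- by rewrite (nth_default 0) ?mul0r //; apply: leq_trans (sz i) _; lia.
Qed.

End Multiplicity.

(** * Wronskians of independent polynomials *)

Section Wronskian.
Variables (F : fieldType) (J : nat).
Implicit Types (f : 'I_J -> {poly F}).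

Definition wronskian_mx f := \matrix_(i < J, r < J) iter r (@xderiv F) (f i).
Definition wronskian f := \det (wronskian_mx f).
Definition with_row f i0 g := fun i => if i == i0 then g else f i.

Lemma wronskian_row f i0 g :
  wronskian (with_row f i0 g) = \sum_(r < J) iter r (@xderiv F) g * cofactor (wronskian_mx f) i0 r.
Proof.
rewrite /wronskian (expand_det_row _ i0); apply: eq_bigr => r _.
rewrite mxE /with_row eqxx; congr (_ * _); rewrite /cofactor; congr (_ * \det _).
by apply/matrixP=> i j; rewrite !mxE eq_sym (negbTE (neq_lift _ _)).
Qed.

Lemma eq_wronskian f f' : f =1 f' -> wronskian f = wronskian f'.
Proof. by move=> e; congr (\det _); apply/matrixP=> i j; rewrite !mxE e. Qed.

Lemma wronskian_row_id f i0 : wronskian (with_row f i0 (f i0)) = wronskian f.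
Proof. by apply: eq_wronskian => i; rewrite /with_row; case: eqP => // ->. Qed.

Lemma wronskian_row_other f i0 j : j != i0 -> wronskian (with_row f i0 (f j)) = 0.
Proof.
move=> ne; apply: (determinant_alternate (i1 := i0) (i2 := j)); first by rewrite eq_sym.
by move=> r; rewrite !mxE /with_row eqxx (negbTE ne).
Qed.

Lemma xderiv_iterD r (g h : {poly F}) : iter r (@xderiv F) (g + h) = iter r (@xderiv F) g + iter r (@xderiv F) h.
Proof. by apply/polyP=> d; rewrite coefD !coef_xderiv_iter coefD mulrDr. Qed.

Lemma xderiv_iterZ r c (g : {poly F}) : iter r (@xderiv F) (c *: g) = c *: iter r (@xderiv F) g.
Proof. by apply/polyP=> d; rewrite coefZ !coef_xderiv_iter coefZ mulrCA. Qed.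

Lemma wronskian_rowD f i0 g h :
  wronskian (with_row f i0 (g + h)) = wronskian (with_row f i0 g) + wronskian (with_row f i0 h).
Proof.
rewrite !wronskian_row -big_split; apply: eq_bigr => r _ /=.
by rewrite xderiv_iterD mulrDl.
Qed.

Lemma wronskian_rowZ f i0 c g : wronskian (with_row f i0 (c *: g)) = c *: wronskian (with_row f i0 g).
Proof.
rewrite !wronskian_row scaler_sumr; apply: eq_bigr => r _ /=.
by rewrite xderiv_iterZ scalerAl.
Qed.

(** Through this a high order of vanishing of the sum, which no single [f i] need have, becomes
    visible in the Wronskian. *)
Lemma wronskian_row_sum f i0 : wronskian (with_row f i0 (\sum_i f i)) = wronskian f.
Proof.
rewrite (bigD1 i0) //= wronskian_rowD wronskian_row_id.
suff -> : wronskian (with_row f i0 (\sum_(i < J | i != i0) f i)) = 0 by rewrite addr0.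
elim/big_rec: _ => [|i g ne IH]; last by rewrite wronskian_rowD IH wronskian_row_other // addr0.
by rewrite -[X in with_row _ _ X](scale0r (0 : {poly F})) wronskian_rowZ scale0r.
Qed.

Definition independent f := forall c : 'I_J -> F, \sum_i c i *: f i = 0 -> forall i, c i = 0.

Lemma independent_neq0 f i : independent f -> f i != 0.
Proof.
move=> ind; apply/eqP=> fi.
have s0 : \sum_j (j == i)%:R *: f j = 0.
  rewrite (bigD1 i) //= fi scaler0 add0r big1 // => j /negbTE ->; exact: scale0r.
by have := ind _ s0 i => /eqP; rewrite eqxx oner_eq0.
Qed.

Lemma signr_scale (b : bool) (g : {poly F}) : (-1) ^+ b * g = (-1) ^+ b *: g.
Proof. by case: b; rewrite ?expr1 ?expr0 ?mulN1r ?scaleN1r ?mul1r ?scale1r. Qed.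

Lemma independent_row_sub f i j c : i != j -> independent f ->
  independent (with_row f i (f i - c *: f j)).
Proof.
move=> ij ind b sb.
have Hb : forall l, b l - (if l == j then c * b i else 0) = 0.
  apply: ind; rewrite -[RHS]sb.
  rewrite [RHS](eq_bigr (fun l => b l *: f l - (if l == i then (c * b i) *: f j else 0))); last first.
    move=> l _; rewrite /with_row; case: eqP => [->|_]; last by rewrite subr0.
    by rewrite scalerBr scalerA mulrC.
  rewrite [LHS](eq_bigr (fun l => b l *: f l - (if l == j then (c * b i) *: f j else 0))); last first.
    by move=> l _; rewrite scalerBl; case: eqP => [->|_] //; rewrite scale0r.
  by rewrite !sumrB -!big_mkcond !big_pred1_eq.
have bi : b i = 0 by have := Hb i; rewrite (negbTE ij) subr0.
by move=> l; have := Hb l; rewrite bi mulr0 if_same subr0.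
Qed.

(** If two degrees coincide, a row operation cancels a leading term and lowers the total size, on
    which the induction runs. If all degrees differ, the top coefficient is the product of the
    leading coefficients times the Vandermonde determinant of the degrees, which stay distinct in
    [F] because they are below [p]. *)
Lemma wronskian_neq0 p f : (forall n, (0 < n < p)%N -> n%:R != 0 :> F) ->
  (forall i, (size (f i) <= p)%N) -> independent f -> wronskian f != 0.
Proof.
move=> ch; have [n] := ubnP (\sum_i size (f i)); elim: n f => // n IH f lt_n szp ind.
have fn0 i := independent_neq0 i ind.
case: (boolP [exists i, exists j, (i != j) && (size (f i) == size (f j))]).
  case/existsP=> i /existsP[j /andP[ij /eqP sij]].
  pose c := lead_coef (f i) / lead_coef (f j); pose g := f i - c *: f j.
  have lt_g : (size g < size (f i))%N.
    have s0 : (0 < size (f i))%N by rewrite size_poly_gt0.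
    rewrite -(ltn_predK s0) ltnS; apply/leq_sizeP => l; rewrite leq_eqVlt => /orP[/eqP <-|lt_l].
      by rewrite coefB coefZ {2}sij -!lead_coefE mulfVK ?lead_coef_eq0 // subrr.
    have [li lj] : (size (f i) <= l /\ size (f j) <= l)%N by rewrite -sij -(ltn_predK s0).
    by rewrite coefB coefZ !nth_default ?mulr0 ?subrr.
  have -> : wronskian f = wronskian (with_row f i g).
    rewrite wronskian_rowD wronskian_row_id -scaleNr wronskian_rowZ.
    by rewrite wronskian_row_other 1?eq_sym // scaler0 addr0.
  apply: IH; last exact: independent_row_sub.
    move: lt_n; rewrite (bigD1 i) //= [X in (X < n)%N](bigD1 i) //= {1}/with_row eqxx.
    have -> : (\sum_(l < J | l != i) size (with_row f i g l) = \sum_(l < J | l != i) size (f l))%N.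
      by apply: eq_bigr => l /negbTE li; rewrite /with_row li.
    by rewrite ltnS => h; apply: leq_trans h; rewrite ltn_add2r.
  by move=> l; rewrite /with_row; case: eqP => // _; apply: leq_trans (ltnW lt_g) _.
move=> /existsPn Hs; pose d i := (size (f i)).-1.
have dinj : injective d.
  move=> i j; rewrite /d => dij; apply/eqP; apply: contraT => ij; have := Hs i.
  move=> /existsPn /(_ j); rewrite ij /=; move: (fn0 i) (fn0 j).
  rewrite -!size_poly_gt0; move: dij; move: (size (f i)) (size (f j)) => a b.
  by case: a b => [|a] [|b] //= ->; rewrite eqxx.
have szd i : (size (f i) <= (d i).+1)%N by rewrite /d; lia.
have top : (wronskian f)`_(\sum_i d i) =
    \det (\matrix_(i, r) (lead_coef (f i) * (d i)%:R ^+ r)).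
  rewrite /wronskian /determinant coef_sum; apply: eq_bigr => s _.
  rewrite signr_scale.
  rewrite coefZ; congr (_ * _).
  have szw i : (size (wronskian_mx f i (s i)) <= (d i).+1)%N.
    by rewrite mxE; apply: leq_trans (size_xderiv_iter _ _) _.
  have [-> _] := coef_prod_top (index_enum 'I_J) szw.
  by apply: eq_bigr => i _; rewrite !mxE coef_xderiv_iter mulrC lead_coefE.
apply/eqP=> w0; move: top; rewrite w0 coef0 => /esym /eqP.
have -> : \matrix_(i, r) (lead_coef (f i) * (d i)%:R ^+ r) =
    diag_mx (\row_i lead_coef (f i)) *m (Vandermonde J (\row_i (d i)%:R))^T.
  by apply/matrixP=> i r; rewrite mul_diag_mx !mxE.
rewrite det_mulmx det_diag det_tr det_Vandermonde mulf_eq0 => /orP[/prodf_eq0[i _]|/prodf_eq0[i _ /prodf_eq0[j ij]]].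
  by rewrite mxE lead_coef_eq0 (negbTE (fn0 i)).
rewrite !mxE; have := szp i; have := szp j; move: (fn0 i) (fn0 j); rewrite -!size_poly_gt0.
have nd : d i != d j by apply: contraTN ij => /eqP /dinj ->; rewrite ltnn.
have dlt l : ((size (f l)).-1 < p)%N.
  by apply: leq_trans (szp l); rewrite ltn_predL size_poly_gt0.
have ch_sub a b : (a < b < p)%N -> (b%:R - a%:R != 0 :> F).
  by move=> ab; rewrite -natrB ?ch //; lia.
rewrite /d in nd *; move=> si sj lei lej; apply/negP.
have [lt|lt|e] := ltngtP (size (f i)).-1 (size (f j)).-1; last by rewrite e eqxx in nd.
  by apply: ch_sub; rewrite lt dlt.
by rewrite -opprB oppr_eq0; apply: ch_sub; rewrite lt dlt.
Qed.

(** Every term of the determinant takes one entry from each row, and at most [J - 1] applications of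
    the operator cost that row at most [J - 1] orders. *)
Lemma dvdp_wronskian f (z : F) (m : 'I_J -> nat) :
  (forall i, ('X - z%:P) ^+ m i %| f i) ->
  ('X - z%:P) ^+ (\sum_i (m i - J.-1)) %| wronskian f.
Proof.
move=> dv; rewrite /wronskian /determinant -prodrXr; set E := \prod_i _.
elim/big_rec: _ => [|s g _ IHg]; first exact: dvdp0.
apply: dvdp_add IHg; apply: dvdp_mull.
rewrite /E; elim/big_rec2: _ => [|i u v _ IH]; first exact: dvdpp.
apply: dvdp_mul => //; rewrite mxE; apply: dvdp_trans (dvdp_xderiv_iter _ (dv i)).
by apply: dvdp_exp2l; have := ltn_ord (s i); lia.
Qed.

Lemma size_wronskian f : (size (wronskian f) <= (\sum_i (size (f i)).-1).+1)%N.
Proof.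
rewrite /wronskian /determinant; apply: leq_trans (size_sum _ _ _) _; apply/bigmax_leqP => s _.
rewrite signr_scale.
apply: leq_trans (size_scale_leq _ _) _.
have szw i : (size (wronskian_mx f i (s i)) <= (size (f i)).-1.+1)%N.
  by rewrite mxE; apply: leq_trans (size_xderiv_iter _ _) _; exact: leqSpred.
by have [_] := coef_prod_top (index_enum 'I_J) szw.
Qed.

End Wronskian.

(** * Underdetermined linear systems *)

Section LinearAlgebra.
Variable F : fieldType.

Lemma exists_kernel_vector (U E : finType) (a : E -> U -> F) : (#|E| < #|U|)%N ->
  exists c : U -> F, (exists u, c u != 0) /\ forall x, \sum_u c u * a x u = 0.
Proof.
move=> ltEU; pose M := \matrix_(i < #|U|, j < #|E|) a (enum_val j) (enum_val i).
have : kermx M != 0.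
  rewrite -mxrank_eq0 mxrank_ker -lt0n subn_gt0; apply: leq_ltn_trans ltEU; exact: rank_leq_col.
case/rowV0Pn=> v /sub_kermxP vM /rV0Pn[i vi].
exists (fun u => v 0 (enum_rank u)); split; first by exists (enum_val i); rewrite enum_valK.
move=> x; have /matrixP/(_ 0 (enum_rank x)) := vM; rewrite !mxE => vMx; rewrite -[RHS]vMx.
rewrite (reindex (fun j : 'I_#|U| => enum_val j)) /=; last exact/onW_bij/enum_val_bij.
by apply: eq_bigr => j _; rewrite !mxE enum_valK enum_rankK.
Qed.

End LinearAlgebra.

(** * The Stepanov argument for products of powers *)

Section PowerProducts.
Variables (F : fieldType) (p k e B : nat) (z : 'I_k -> F).
Hypothesis ch : forall n, (0 < n < p)%N -> n%:R != 0 :> F.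
Hypothesis zinj : injective z.

Local Notation expo := {ffun 'I_k -> 'I_B}.
Local Notation lin i := ('X - (z i)%:P).

Definition power_prod (b : expo) : {poly F} := \prod_(i < k) lin i ^+ (e * b i).

Lemma size_power_prod b : size (power_prod b) = (\sum_(i < k) e * b i).+1.
Proof.
rewrite /power_prod size_prod => [|i _]; last by rewrite expf_neq0 // polyXsubC_eq0.
rewrite (eq_bigr (fun i => e * b i + 1)%N) => [|i _]; last by rewrite size_exp_XsubC addn1.
by rewrite big_split /= sum1_card -addSn addnK.
Qed.

Lemma power_prod_neq0 b : power_prod b != 0.
Proof. by rewrite -size_poly_gt0 size_power_prod. Qed.

Lemma dvdp_power_prod (b : expo) i m : (m <= e * b i)%N -> lin i ^+ m %| power_prod b.
Proof.
move=> le_m; rewrite /power_prod (bigD1 i) //=; apply: dvdp_mulr; exact: dvdp_exp2l.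
Qed.

Lemma sum_expo_leq (b : expo) : (\sum_(i < k) e * b i <= e * k * B)%N.
Proof.
apply: (@leq_trans (\sum_(i < k) e * B)); first by apply: leq_sum => i _; rewrite leq_mul2l (ltnW (ltn_ord _)) orbT.
by rewrite sum_nat_const card_ord; lia.
Qed.

Lemma size_mul_power_prod A (P : {poly F}) b : (size P <= A)%N ->
  (size (P * power_prod b)%R <= A + e * k * B)%N.
Proof.
move=> sP; apply: leq_trans (size_polyMleq _ _) _; rewrite size_power_prod.
by have := sum_expo_leq b; lia.
Qed.

(* The Wronskian of [J] such products vanishes at each [z i] nearly to the order of their product;
   an extra factor [lin t ^+ e] in their sum is too much for its degree. *)
Lemma independent_products_bound J A (f P : 'I_J -> {poly F}) (b : 'I_J -> expo) t v :
  (0 < J)%N -> independent f -> (forall j, size (f j) <= p)%N ->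
  (forall j, f j = P j * power_prod (b j)) -> (forall j, size (P j) <= A)%N ->
  (forall j, b j t = v) -> lin t ^+ (e * v.+1) %| \sum_j f j ->
  (e <= J * (A + k * J))%N.
Proof.
move=> J0 ind szf fE szP bt dv.
have W0 := wronskian_neq0 ch szf ind.
pose j0 := Ordinal J0.
(* At [z t] row [j0] is replaced by the sum of the family and so gains [e] further orders; at the
   other points the family is taken as it is. *)
pose m j i := (e * b j i + (if (i == t) && (j == j0) then e else 0))%N.
have dW i : lin i ^+ (\sum_j (m j i - J.-1)) %| wronskian f.
  have [->|it] := eqVneq i t; last first.
    apply: dvdp_wronskian => j; rewrite /m (negbTE it) addn0 fE.
    by apply: dvdp_mull; apply: dvdp_power_prod.
  rewrite -(wronskian_row_sum f j0); apply: dvdp_wronskian => j.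
  rewrite /m /with_row eqxx /=; case: eqP => [_|_].
    by rewrite /= bt addnC -mulnS.
  by rewrite /= addn0 fE; apply: dvdp_mull; apply: dvdp_power_prod.
have lt1 := sum_mult_lt_size W0 (index_enum_uniq 'I_k) (in2W zinj) (in1W dW).
have lt2 := leq_trans lt1 (size_wronskian f).
have le3 : (\sum_j (size (f j)).-1 <= \sum_j (A + \sum_i e * b j i))%N.
  apply: leq_sum => j _; rewrite fE.
  have := size_polyMleq (P j) (power_prod (b j)); rewrite size_power_prod.
  by move: (szP j); move: (size (P j * _)) (size (P j)) (\sum_(i < k) _)%N => *; lia.
(* Derivation loses fewer than [J] orders in each of the [J] rows, at each of the [k] points. *)
have le4 : (\sum_(i < k) \sum_j m j i <= \sum_(i < k) \sum_j (m j i - J.-1) + k * (J * J))%N.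
  have -> : (k * (J * J) = \sum_(i < k) \sum_(j < J) J)%N.
    by rewrite !sum_nat_const !card_ord.
  rewrite -big_split /=; apply: leq_sum => i _; rewrite -big_split /=.
  by apply: leq_sum => j _; lia.
have E5 : (\sum_(i < k) \sum_j m j i = \sum_j \sum_i e * b j i + e)%N.
  rewrite exchange_big /= (bigD1 j0) //= [in RHS](bigD1 j0) //=.
  have -> : (\sum_(j < J | j != j0) \sum_(i < k) m j i = \sum_(j < J | j != j0) \sum_i e * b j i)%N.
    apply: eq_bigr => j /negbTE jj; apply: eq_bigr => i _.
    by rewrite /m jj andbF addn0.
  rewrite /m big_split /= -!addnA; congr (_ + _)%N; rewrite addnC; congr (_ + _)%N.
  by rewrite eqxx -big_mkcond /=; under eq_bigl do rewrite andbT; rewrite big_pred1_eq.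
have E6 : (\sum_j (A + \sum_i e * b j i) = J * A + \sum_j \sum_i e * b j i)%N.
  by rewrite big_split /= sum_nat_const card_ord.
rewrite ltnS in lt2; have := leq_trans le4 (leq_add (leq_trans lt2 le3) (leqnn _)).
by rewrite E5 E6 mulnDr [(J * (k * J))%N]mulnCA addnAC [X in (_ <= X)%N]addnC leq_add2l.
Qed.

Definition agree t (b b' : expo) := [forall i : 'I_k, (i < t)%N ==> (b i == b' i)].

Lemma card_fixed_coordinate (C : {set expo}) t v : (forall b, b \in C -> b t = v) ->
  (#|C| <= B ^ k.-1)%N.
Proof.
move=> Cv; have k0 : (0 < k)%N by apply: leq_ltn_trans (ltn_ord t).
have B0 : (0 < B)%N by apply: leq_ltn_trans (ltn_ord v).
pose h (x : expo * 'I_B) : expo := [ffun i => if i == t then x.2 else x.1 i].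
have hinj : {in setX C [set: 'I_B] &, injective h}.
  move=> [b x] [b' x'] /setXP[bC _] /setXP[b'C _] /ffunP eh; congr (_, _).
    apply/ffunP=> i; have := eh i; rewrite !ffunE /=.
    by case: eqP => // -> _; rewrite (Cv b) ?(Cv b').
  by have := eh t; rewrite !ffunE eqxx.
have := max_card (mem (h @: setX C [set: 'I_B])).
rewrite card_in_imset // cardsX cardsT card_ffun !card_ord.
by rewrite -[X in (_ <= _ ^ X)%N](prednK k0) expnSr leq_pmul2r.
Qed.

(** Exponent tuples are split by one coordinate after the other. Within a class fixed on the
    coordinates below [t], let [C] collect the nonzero terms of least [t]-th exponent. All other
    terms are divisible by a higher power of [lin t], hence so is the sum over [C], whose terms are
    independent by induction. Then [independent_products_bound] contradicts the size of [e], as [C]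
    has at most [B ^ k.-1] elements. *)
Lemma power_prods_independent A (P : expo -> {poly F}) :
  (B ^ k.-1 * (A + k * B ^ k.-1) < e)%N -> (A + e * k * B <= p)%N ->
  (forall b, size (P b) <= A)%N -> \sum_b P b * power_prod b = 0 -> forall b, P b = 0.
Proof.
move=> e_large p_large szP sum0 b.
have claim : forall n t beta (Q : expo -> {poly F}), (n + t = k)%N -> (forall b, size (Q b) <= A)%N ->
    \sum_(b | agree t b beta) Q b * power_prod b = 0 -> forall b, agree t b beta -> Q b = 0.
  elim=> [|n IH] t beta Q ntk szQ s0 b' ag.
    have eqb c : agree t c beta = (c == beta).
      apply/forallP/eqP => [ac|-> i]; last by rewrite eqxx implybT.
      by apply/ffunP=> i; apply/eqP; have := ac i; rewrite (_ : (i < t)%N) //; have := ltn_ord i; move: ntk; lia.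
    move: s0 ag; rewrite (eq_bigl (pred1 beta)) // big_pred1_eq eqb => /eqP.
    by rewrite mulf_eq0 (negbTE (power_prod_neq0 _)) orbF => /eqP ? /eqP ->.
  have tk : (t < k)%N by lia.
  pose ot := Ordinal tk.
  apply/eqP; apply: contraT => Qb'.
  pose S := [pred c : expo | agree t c beta && (Q c != 0)].
  have Sb' : S b' by rewrite /= ag.
  have [b0 /andP[ag0 Qb0] b0min] := arg_minnP (fun c : expo => c ot : nat) Sb'.
  pose C := [set c : expo | S c && (c ot == b0 ot)].
  have agS c : agree t.+1 c b0 = agree t c beta && (c ot == b0 ot).
    apply/forallP/andP => [H|[/forallP H1 /eqP H2] i].
      split; last by have /implyP/(_ (ltnSn t)) := H ot.
      apply/forallP=> i; apply/implyP=> it.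
      have /implyP/(_ (ltnW it)) /eqP -> := H i.
      by have /forallP/(_ i)/implyP/(_ it) := ag0.
    apply/implyP; rewrite ltnS leq_eqVlt => /orP[/eqP it|it].
      by have -> : i = ot by [apply: val_inj]; rewrite H2.
    have /implyP/(_ it) /eqP -> := H1 i.
    by rewrite eq_sym; have /forallP/(_ i)/implyP/(_ it) := ag0.
  have b0C : b0 \in C by rewrite inE /= ag0 Qb0 eqxx.
  pose f (j : 'I_#|C|) := Q (enum_val j) * power_prod (enum_val j).
  have valC (j : 'I_#|C|) := enum_valP j.
  have ind : independent f.
    (* A linear relation among the terms of [C] is again a vanishing sum of the same kind, over
       tuples that agree in one more coordinate. *)
    move=> c sc j.
    pose Q' b := if b \in C then c (enum_rank_in b0C b) *: Q b else 0.
    have Q'0 : Q' (enum_val j) = 0.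
      apply: (IH t.+1 b0 Q') => [|b1||]; first by lia.
      - rewrite /Q'; case: ifP => _; last by rewrite size_poly0.
        by apply: leq_trans (size_scale_leq _ _) _.
      - rewrite -[RHS]sc (bigID (mem C)) /= [X in _ + X]big1 ?addr0; last first.
          move=> b1 /andP[_ b1C].
          by rewrite /Q' (negbTE b1C) mul0r.
        rewrite (eq_bigl (mem C)) => [|b1]; last first.
          rewrite -[RHS]/(b1 \in C) agS !inE /=.
          by case: (agree t b1 beta); case: (b1 ot == b0 ot); case: (Q b1 != 0).
        rewrite big_enum_val /=; apply: eq_bigr => l _.
        by rewrite /Q' enum_valP enum_valK_in /f scalerAl.
      - by rewrite agS; move: (valC j); rewrite inE /= => /andP[/andP[-> _] ->].
    move: Q'0; rewrite /Q' valC enum_valK_in => /eqP.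
    rewrite scaler_eq0 => /orP[/eqP //|].
    by move: (valC j); rewrite inE /= => /andP[/andP[_ /negP Qj] _] Q0; case: Qj.
  have C0 : (0 < #|C|)%N by apply/card_gt0P; exists b0.
  have sumf : lin ot ^+ (e * (b0 ot).+1) %| \sum_j f j.
    have -> : \sum_j f j = \sum_(c in C) Q c * power_prod c by rewrite [RHS]big_enum_val.
    have -> : \sum_(c in C) Q c * power_prod c =
        - \sum_(c | agree t c beta && (c \notin C)) Q c * power_prod c.
      apply/eqP; rewrite -addr_eq0; apply/eqP; rewrite -[RHS]s0 [RHS](bigID (mem C)) /=; congr (_ + _).
      by apply: eq_bigl => c; rewrite inE /=; case: (agree t c beta); rewrite ?andbF.
    rewrite dvdpNr; elim/big_rec: _ => [|c g /andP[agc cC] IHg]; first exact: dvdp0.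
    apply: dvdp_add IHg; have [->|Qc] := eqVneq (Q c) 0; first by rewrite mul0r dvdp0.
    apply: dvdp_mull; apply: dvdp_power_prod; rewrite leq_mul2l; apply/orP; right.
    have := b0min c; rewrite /= agc Qc => /(_ isT); rewrite leq_eqVlt => /orP[/eqP e0|//].
    by move: cC; rewrite inE /= agc Qc -val_eqE /= -e0 eqxx.
  have cardC : (#|C| <= B ^ k.-1)%N.
    by apply: (@card_fixed_coordinate C ot (b0 ot)) => c; rewrite inE => /andP[_ /eqP].
  have := @independent_products_bound #|C| A f _ _ ot (b0 ot) C0 ind _ (fun=> erefl) _ _ sumf.
  suff: ~ (e <= #|C| * (A + k * #|C|))%N.
    move=> ne H; exfalso; apply: ne; apply: H => j //.
      by apply: leq_trans p_large; apply: size_mul_power_prod.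
    by move: (valC j); rewrite inE => /andP[_ /eqP].
  apply/negP; rewrite -ltnNge; apply: leq_ltn_trans e_large.
  by apply: leq_mul => //; rewrite leq_add2l leq_mul2l cardC orbT.
by apply: (claim k 0 b P) => //; [rewrite addn0 | rewrite -[RHS]sum0; apply: eq_bigl => c; apply/forallP | apply/forallP].
Qed.

Local Notation Pi := (\prod_(i < k) lin i).

(** A plain derivative would lower the powers of the linear factors. With the factor [Pi] the
    multiples of each [power_prod b] are preserved, at the price of up to [k] more degrees per
    step. *)
Definition pderiv (f : {poly F}) := Pi * f^`().

Lemma pderiv_sum (I : finType) m (c : I -> F) (g : I -> {poly F}) :
  iter m pderiv (\sum_i c i *: g i) = \sum_i c i *: iter m pderiv (g i).
Proof.
elim: m => [|m IH] //=; rewrite IH /pderiv raddf_sum mulr_sumr.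
by apply: eq_bigr => i _ /=; rewrite derivZ scalerAr.
Qed.

Lemma power_prod_log_deriv b :
  exists T : {poly F}, (size T <= k)%N /\ Pi * (power_prod b)^`() = T * power_prod b.
Proof.
suff [T [szT ET]] : exists T : {poly F}, (size T <= size (index_enum 'I_k))%N /\
    Pi * (power_prod b)^`() = T * power_prod b.
  exists T; split=> //; apply: leq_trans szT _; rewrite -[X in (_ <= X)%N]card_ord -sum1_card -sum1_size.
  by apply: eq_leq; apply: eq_bigl.
rewrite /power_prod; elim: (index_enum _) => [|i r [T [szT ET]]].
  by exists 0; rewrite !big_nil size_poly0 derivC mulr0 mul0r.
pose c := (e * b i)%N; set G := \prod_(i <- r) _ ^+ _ in ET *; set R := \prod_(i <- r) _ in ET *.
exists (c%:R *: R + lin i * T); split.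
  apply: leq_trans (size_polyD _ _) _; rewrite geq_max; apply/andP; split.
    apply: leq_trans (size_scale_leq _ _) _; rewrite /R size_prod_seq => [|j _]; last exact: negbT (polyXsubC_eq0 _).
    rewrite (eq_bigr (fun=> 2%N)) => [|j _]; last exact: size_XsubC.
    by rewrite big_const_seq count_predT iter_addn /=; lia.
  by apply: leq_trans (size_polyMleq _ _) _; rewrite size_XsubC addSn add1n.
rewrite !big_cons -/G -/R -/c derivM deriv_exp derivXsubC mul1r -!mul_polyC.
set L := lin i; set X := L ^+ c.-1 *+ c; set C := (c%:R)%:P.
have XL : X * L = C * L ^+ c.
  rewrite /X /C; case: (c) => [|n]; first by rewrite mulr0n !mul0r.
  by rewrite /= mulrnAl -exprSr polyC_natr mulr_natl.
transitivity ((X * L) * (R * G) + L ^+ c * L * (R * G^`())); first by ring.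
by rewrite XL ET; ring.
Qed.

Lemma pderiv_power_prod b : exists D : {poly F} -> {poly F},
  (forall g, (size (D g) <= size g + k)%N) /\
  forall g, pderiv (g * power_prod b) = D g * power_prod b.
Proof.
have [T [szT ET]] := power_prod_log_deriv b.
exists (fun g => Pi * g^`() + T * g); split=> g; last first.
  by rewrite /pderiv derivM mulrDr mulrDl !mulrA [Pi * g]mulrC -[g * Pi * _]mulrA ET; ring.
have [->|g0] := eqVneq g 0; first by rewrite derivC !mulr0 addr0 size_poly0.
have szg : (0 < size g)%N by rewrite size_poly_gt0.
apply: leq_trans (size_polyD _ _) _; rewrite geq_max; apply/andP; split.
  apply: leq_trans (size_polyMleq _ _) _.
  have -> : size Pi = k.+1.
    rewrite size_prod => [|i _]; last exact: negbT (polyXsubC_eq0 _).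
    rewrite (eq_bigr (fun=> 2%N)) => [|i _]; last exact: size_XsubC.
    by rewrite sum_nat_const card_ord; lia.
  by rewrite addSn addnC leq_add2r ltnW // lt_size_deriv.
apply: leq_trans (size_polyMleq _ _) _.
by apply: leq_trans (leq_pred _) _; rewrite addnC leq_add2l.
Qed.

(** At an exact zero of order [n] with [0 < n < p] the operator leaves order exactly [n - 1],
    because neither [n] nor [Pi] vanishes there; so vanishing of the iterates cannot be caused by
    the characteristic. *)
Lemma dvdp_of_pderiv_roots (f : {poly F}) y M : Pi.[y] != 0 -> (M <= p)%N ->
  (forall m, (m < M)%N -> (iter m pderiv f).[y] = 0) -> ('X - y%:P) ^+ M %| f.
Proof.
move=> Piy; elim: M f => [|M IH] f Mp fy; first by rewrite dvd1p.
have [->|f0] := eqVneq f 0; first exact: dvdp0.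
have dE : ('X - y%:P) ^+ M %| pderiv f.
  by apply: IH => [|m lt_m]; [apply: ltnW | rewrite -iterSr; apply: fy].
rewrite -mup_geq // leqNgt; apply/negP => lt_n.
set n := mup y f in lt_n *.
have n0 : (0 < n)%N by rewrite -XsubC_dvd // dvdp_XsubCl; apply/rootP; exact: (fy 0%N).
have /dvdpP[g fE] : ('X - y%:P) ^+ n %| f by rewrite -mup_geq.
have gy : g.[y] != 0.
  apply/eqP=> gy; suff : (n.+1 <= n)%N by rewrite ltnn.
  by rewrite {2}/n mup_geq // fE exprS dvdp_mul // dvdp_XsubCl; apply/rootP.
clearbody n.
have : ('X - y%:P) ^+ n %| pderiv f by apply: dvdp_trans dE; apply: dvdp_exp2l.
rewrite /pderiv fE derivM deriv_exp derivXsubC mul1r.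
have -> : Pi * (g^`() * ('X - y%:P) ^+ n + g * (('X - y%:P) ^+ n.-1 *+ n)) =
    (Pi * (g^`() * ('X - y%:P) + g *+ n)) * ('X - y%:P) ^+ n.-1.
  rewrite -{1}(prednK n0) exprS; move: (('X - y%:P) ^+ n.-1) => u.
  by rewrite -[u *+ n]mulr_natr -[g *+ n]mulr_natr; ring.
rewrite -{1}(prednK n0) exprS dvdp_mul2r ?expf_neq0 ?polyXsubC_eq0 // dvdp_XsubCl => /rootP.
rewrite !hornerE subrr mulr0 add0r hornerMn -mulr_natr => /eqP.
rewrite !mulf_eq0 (negbTE Piy) (negbTE gy) /=; apply/negP/ch; lia.
Qed.

(* [u = (b, l)] stands for the product ['X^l * power_prod b]. On [Y] the factor [power_prod b] takes the
   constant value [gam b], so the [m]-th [pderiv] of a combination agrees there with a polynomial of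
   size at most [A + k * M], whose coefficients we make vanish for all [m < M]. *)
Lemma stepanov A M (a : 'I_k -> F) (Y : seq F) :
  (M * (A + k * M) < A * B ^ k)%N -> (B ^ k.-1 * (A + k * B ^ k.-1) < e)%N ->
  (A + e * k * B <= p)%N -> (M <= p)%N -> (forall i, a i != 0) -> uniq Y ->
  (forall y i, y \in Y -> (y - z i) ^+ e = a i) -> (size Y * M < A + e * k * B)%N.
Proof.
move=> few_eq e_large p_large Mp a0 uY Ya.
have e0 : (0 < e)%N by apply: leq_ltn_trans e_large.
have [D HD] := fin_all_exists pderiv_power_prod.
pose gam (b : expo) := \prod_(i < k) a i ^+ b i.
pose eqn (x : 'I_M * 'I_(A + k * M)) (u : expo * 'I_A) := gam u.1 * (iter x.1 (D u.1) 'X^(u.2))`_x.2.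
have [|c [[u0 cu0] ceq]] := exists_kernel_vector eqn.
  by rewrite !card_prod card_ffun !card_ord mulnC [in X in (_ < X)%N]mulnC mulnC.
have szD b m g : (size (iter m (D b) g) <= size g + k * m)%N.
  elim: m => [|m IH]; first by rewrite muln0 addn0.
  by apply: leq_trans (proj1 (HD b) _) _; rewrite mulnS [(k + _)%N]addnC addnA leq_add2r.
have itD b m g : iter m pderiv (g * power_prod b) = iter m (D b) g * power_prod b.
  by elim: m => [|m IH] //=; rewrite IH (proj2 (HD b)).
pose R m := \sum_u (c u * gam u.1) *: iter m (D u.1) 'X^(u.2).
have R0 m : (m < M)%N -> R m = 0.
  move=> lt_m; apply/polyP=> j; rewrite coef0.
  have [lt_j|le_j] := ltnP j (A + k * M); last first.
    apply: nth_default; apply: leq_trans le_j; apply: leq_trans (size_sum _ _ _) _.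
    apply/bigmax_leqP => u _; apply: leq_trans (size_scale_leq _ _) _.
    apply: leq_trans (szD _ _ _) _; rewrite size_polyXn; apply: leq_add; first exact: ltn_ord.
    by rewrite leq_mul2l (ltnW lt_m) orbT.
  have := ceq (Ordinal lt_m, Ordinal lt_j); rewrite /eqn /= => H; rewrite -[RHS]H /R coef_sum.
  by apply: eq_bigr => u _; rewrite coefZ mulrA.
pose f := \sum_u c u *: ('X^(u.2) * power_prod u.1).
pose P (b : expo) := \sum_(l < A) c (b, l) *: 'X^l.
have fE : f = \sum_b P b * power_prod b.
  rewrite /f (eq_bigr (fun u => (fun b l => c (b, l) *: ('X^l * power_prod b)) u.1 u.2)) => [|[b l] //].
  rewrite -(pair_bigA _ (fun b (l : 'I_A) => c (b, l) *: ('X^l * power_prod b))) /=.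
  by apply: eq_bigr => b _; rewrite /P mulr_suml; apply: eq_bigr => l _; rewrite scalerAl.
have szP b : (size (P b) <= A)%N.
  apply: leq_trans (size_sum _ _ _) _; apply/bigmax_leqP => l _.
  by apply: leq_trans (size_scale_leq _ _) _; rewrite size_polyXn.
(* If [f] were zero, independence would force every [P b], and with it every coefficient [c], to be
   0. *)
have f0 : f != 0.
  apply: contraNneq cu0 => f0; move: u0 => [b l].
  have := power_prods_independent e_large p_large szP; rewrite -fE => /(_ f0 b) /(congr1 (fun q : {poly F} => q`_l)).
  rewrite coef0 /P coef_sum (bigD1 l) //= coefZ coefXn eqxx mulr1 big1 ?addr0 => [-> //|j ne].
  by rewrite coefZ coefXn eq_sym (negbTE (_ : (j : nat) != l)) ?mulr0.
have szf : (size f <= A + e * k * B)%N.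
  rewrite fE; apply: leq_trans (size_sum _ _ _) _; apply/bigmax_leqP => b _.
  exact: size_mul_power_prod.
apply: leq_trans szf.
have := @sum_mult_lt_size F _ Y id (fun=> M) f f0 uY (in2W (@inj_id F)).
rewrite big_const_seq count_predT iter_addn addn0 mulnC; apply => y yY.
have yz i : y - z i != 0.
  by apply: contraNneq (a0 i) => yz; rewrite -(Ya y i yY) yz expr0n eqn0Ngt e0.
apply: dvdp_of_pderiv_roots => // [|m lt_m].
  by rewrite horner_prod; apply/prodf_neq0 => i _; rewrite !hornerE.
have := congr1 (horner^~ y) (R0 m lt_m); rewrite horner0 /f pderiv_sum => Ry; rewrite -[RHS]Ry /R.
rewrite !horner_sum; apply: eq_bigr => u _; rewrite itD !hornerE.
have -> : (power_prod u.1).[y] = gam u.1; last by rewrite [in RHS]mulrAC.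
rewrite /power_prod horner_prod; apply: eq_bigr => i _.
by rewrite horner_exp !hornerE exprM Ya.
Qed.

End PowerProducts.

(** * Simultaneous power equations *)

Section Collisions.
Variables (F : finFieldType) (p : nat).
Hypothesis ch : forall n, (0 < n < p)%N -> n%:R != 0 :> F.

(** Here [stepanov] is used with [A = k * J] and [M = J], where [J = B ^ k.-1]. The [k * B * J ^ 2]
    unknowns outnumber the [2 * k * J ^ 2] equations as soon as [B > 2], and independence asks for
    the same [2 * k * J ^ 2] to be below [e]. *)
Lemma card_affine_solutions k e B (w : 'I_k -> F) (a : 'I_k -> F) (Y : {set F}) :
  (0 < k)%N -> (2 < B)%N -> (2 * k * (B ^ k.-1 * B ^ k.-1) < e)%N ->
  (2 * k * e * B <= p)%N -> injective w -> (forall i, a i != 0) ->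
  (forall y i, y \in Y -> (y + w i) ^+ e = a i) ->
  (#|Y| * B ^ k.-1 <= 2 * k * e * B)%N.
Proof.
move=> k0 B2 e_large p_large winj a0 Ya.
have BkE : (B ^ k = B * B ^ k.-1)%N by rewrite -expnS prednK.
have J0 : (0 < B ^ k.-1)%N by rewrite expn_gt0; lia.
move: (B ^ k.-1)%N BkE J0 e_large => J BkE J0 e_large.
have JJ : (J <= J * J)%N by rewrite leq_pmulr.
have kJJ : (J * J <= k * (J * J))%N by rewrite leq_pmull.
have kJ : (k * J <= e * k * B)%N.
  by rewrite [(e * k)%N]mulnC -mulnA leq_mul2l; apply/orP; right; apply: leq_trans (leq_pmulr _ _); lia.
have := @stepanov F p k e B (fun i => - w i) ch _ (k * J) J a (enum Y).
rewrite -cardE BkE (_ : B ^ k.-1 = J)%N; last first.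
  by apply/eqP; rewrite -(eqn_pmul2l (_ : 0 < B)%N) -?expnS ?prednK ?BkE //; lia.
move=> H; apply: leq_trans (ltnW (H _ _ _ _ _ _ _ _)) _ => //.
- by move=> i j /oppr_inj /winj.
- rewrite (_ : (k * J * (B * J) = J * (k * J * B))%N); last by lia.
  rewrite ltn_pmul2l //; have : (0 < k * J)%N by rewrite muln_gt0 k0.
  by move: (k * J)%N => q q0; nia.
- by apply: leq_ltn_trans e_large; lia.
- by apply: leq_trans p_large; lia.
- by apply: leq_trans p_large; nia.
- exact: enum_uniq.
- by move=> y i; rewrite mem_enum opprK; apply: Ya.
- by lia.
Qed.

(* With [y = (x + v 0)^-1] and [w i = (v i - v 0)^-1] one has [y + w i = (x + v i) * y * w i], so the
   equations become [(y + w i) ^+ e = w i ^+ e]. *)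
Lemma card_projective_solutions k e B (v : 'I_k.+1 -> F) (X : {set F}) :
  (0 < k)%N -> (2 < B)%N -> (2 * k * (B ^ k.-1 * B ^ k.-1) < e)%N ->
  (2 * k * e * B <= p)%N -> injective v ->
  (forall x i, x \in X -> (x + v i) ^+ e = (x + v ord0) ^+ e /\ x + v ord0 != 0) ->
  (#|X| * B ^ k.-1 <= 2 * k * e * B)%N.
Proof.
move=> k0 B2 e_large p_large vinj Xv.
pose w i := (v (lift ord0 i) - v ord0)^-1.
have vd i : v (lift ord0 i) - v ord0 != 0.
  by rewrite subr_eq0; apply: contraTneq isT => /vinj /eqP; rewrite eq_sym (negbTE (neq_lift _ _)).
have iinj : injective (fun x : F => (x + v ord0)^-1) by move=> x y /invr_inj /addIr.
rewrite -(card_imset _ iinj).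
apply: (@card_affine_solutions k e B w (fun i => w i ^+ e)) => //.
- move=> i j /invr_inj /addIr /vinj; exact: lift_inj.
- by move=> i; rewrite expf_neq0 // invr_neq0.
- move=> _ i /imsetP[x xX ->]; have [Ei x0] := Xv x (lift ord0 i) xX.
  have -> : (x + v ord0)^-1 + w i = (x + v (lift ord0 i)) * (x + v ord0)^-1 * w i.
    apply: (mulIf x0); apply: (mulIf (vd i)); rewrite mulrDl mulrDl mulVf // mul1r.
    by rewrite -[w i * _ * _]mulrA [(x + v ord0) * _]mulrC mulrA mulVf // mul1r -!mulrA
      [(x + v ord0) * (_ - _)]mulrC [w i * _]mulrA mulVf // mul1r mulVf // mulr1; ring.
  by rewrite !exprMn Ei exprVn divff ?mul1r // expf_neq0.
Qed.

(** The difference of the two powers is a polynomial of degree at most [e], and it is nonzero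
    because it does not vanish at [- u]. *)
Lemma card_collisions e (u v : F) : (0 < e)%N -> u != v ->
  (#|[set x : F | (x + u) ^+ e == (x + v) ^+ e]| <= e)%N.
Proof.
move=> e0 uv; pose f := ('X + u%:P) ^+ e - ('X + v%:P) ^+ e : {poly F}.
have f0 : f != 0.
  apply: contraNneq uv => f0; have := congr1 (horner^~ (- u)) f0.
  rewrite horner0 !hornerE addNr expr0n eqn0Ngt e0 sub0r => /eqP.
  by rewrite oppr_eq0 expf_eq0 e0 /= addrC subr_eq0 eq_sym.
have szf : (size f <= e.+1)%N.
  apply: leq_trans (size_polyD _ _) _; rewrite geq_max size_polyN.
  have sz w : size (('X + w%:P) ^+ e : {poly F}) = e.+1.
    by rewrite -[w]opprK polyCN size_exp_XsubC.
  by rewrite !sz leqnn.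
have := @max_poly_roots _ f (enum [set x : F | (x + u) ^+ e == (x + v) ^+ e]) f0.
rewrite -cardE enum_uniq => /(_ _ isT) H; rewrite -ltnS; apply: leq_trans szf; apply: H.
apply/allP => x; rewrite mem_enum inE => /eqP E.
by rewrite /root !hornerE E subrr.
Qed.

End Collisions.

(** * Binomial estimates and double counting *)

Section DoubleCounting.

Lemma ffact_leq_exp n k : (n ^_ k <= n ^ k)%N.
Proof. by elim: k => [|k IH]; rewrite // ffactnSr expnSr leq_mul // leq_subr. Qed.

Lemma exp_leq_ffact n m k : (k <= m)%N -> ((n - m) ^ k <= n ^_ k)%N.
Proof.
elim: k => [|k IH] // lt_k; rewrite ffactnSr expnSr leq_mul ?IH ?leq_sub2l //; exact: ltnW.
Qed.

Lemma leq_exp2rW m n k : (m <= n)%N -> (m ^ k <= n ^ k)%N.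
Proof. by case: k => // k; rewrite leq_exp2r. Qed.

(** From [2 * k <= m] one gets [n <= m * D <= 2 * D * (m - k)], and falling factorials lie between
    [(m - k) ^ k] and [n ^ k]. *)
Lemma bin_leq_scaled n m k D : (2 * k <= m)%N -> (n <= m * D)%N ->
  ('C(n, k) <= (2 * D) ^ k * 'C(m, k))%N.
Proof.
move=> km nm; rewrite -(leq_pmul2r (fact_gt0 k)) -mulnA !bin_ffact.
apply: leq_trans (ffact_leq_exp n k) _; apply: leq_trans (leq_exp2rW k nm) _.
apply: leq_trans (leq_mul (leqnn _) (exp_leq_ffact m (leqnn k))).
by rewrite -expnMn; apply: leq_exp2rW; nia.
Qed.

(** Both sides estimate the number of pairs of some [x] in [X] and a [k]-subset of [C x]. *)
Lemma double_count (T U : finType) (S : {set T}) (X : {set U}) (C : U -> {set T}) m k t :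
  (forall x, x \in X -> C x \subset S /\ m <= #|C x|)%N ->
  (forall V : {set T}, #|V| = k -> #|[set x in X | V \subset C x]| <= t)%N ->
  (#|X| * 'C(m, k) <= 'C(#|S|, k) * t)%N.
Proof.
move=> CX Vt.
apply: (@leq_trans (\sum_(x in X) #|[set V : {set T} | (V \subset C x) && (#|V| == k)]|)%N).
  rewrite -sum_nat_const; apply: leq_sum => x xX; rewrite cards_draws.
  by apply: leq_bin2l; case: (CX x xX).
rewrite -cards_draws -sum_nat_const.
under eq_bigr do rewrite -sum1_card big_mkcond.
rewrite exchange_big /= [X in (_ <= X)%N]big_mkcond /=; apply: leq_sum => V _.
rewrite inE; case: ifP => [/andP[_ /eqP cV]|nV].
  apply: leq_trans (Vt V cV); rewrite -sum1_card [X in (_ <= X)%N]big_mkcond [X in (X <= _)%N]big_mkcond /=.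
  by apply: leq_sum => x _; rewrite !inE cV eqxx andbT; case: (x \in X); case: (V \subset C x).
rewrite big1 // => x xX; rewrite inE; case: ifP => // /andP[VC cV].
by rewrite cV (subset_trans VC) // in nV; case: (CX x xX).
Qed.

End DoubleCounting.

(** * Shifts with small classes *)

Section Shifts.
Variables (F : finFieldType) (p e : nat) (S : {set F}).
Hypothesis ch : forall n, (0 < n < p)%N -> n%:R != 0 :> F.
Hypothesis e0 : (0 < e)%N.
Implicit Types X : {set F}.

Definition power_class (x a : F) := [set u in S | (x + u) ^+ e == a].

Lemma exists_injective_shift X : (#|S| * #|S| * e < #|X|)%N ->
  exists2 x, x \in X & forall a, (#|power_class x a| <= 1)%N.
Proof.
move=> ltX; suff /exists_inP[x xX /forallP] : [exists x in X, [forall a, #|power_class x a| <= 1]%N] by exists x.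
move: ltX; apply: contraTT.
rewrite negb_exists_in -leqNgt => /forall_inP Xbad.
pose coll (q : F * F) := [set x : F | (x + q.1) ^+ e == (x + q.2) ^+ e].
pose A := [set q in setX S S | q.1 != q.2].
rewrite -sum1_card; apply: (@leq_trans (\sum_(x in X) \sum_(q in A) (x \in coll q))%N).
  apply: leq_sum => x xX; have /forallPn[a] := Xbad x xX.
  rewrite -ltnNge => /card_gt1P[u [v [+ + uv]]].
  rewrite !inE => /andP[uS /eqP Eu] /andP[vS /eqP Ev].
  by rewrite (bigD1 (u, v)) /= ?inE /= ?uS ?vS ?uv // Eu Ev eqxx.
rewrite exchange_big /=; apply: (@leq_trans (\sum_(q in A) e)%N).
  apply: leq_sum => q; rewrite inE => /andP[_ q12].
  apply: leq_trans (card_collisions e0 q12); rewrite -sum1_card big_mkcond [X in (_ <= X)%N]big_mkcond /=.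
  by apply: leq_sum => x _; rewrite !inE; case: (x \in X) => //; case: eqP.
rewrite sum_nat_const leq_mul2r; apply/orP; right; rewrite -cardsX; apply: subset_leq_card.
by apply/subsetP=> q; rewrite inE => /andP[].
Qed.

(** A single pair of distinct candidates suffices: it collides under at most [e] shifts, and any
    other shift has no class equal to all of [S]. *)
Lemma exists_separating_shift X : (1 < #|S|)%N -> (e < #|X|)%N ->
  exists2 x, x \in X & forall a, (#|power_class x a| < #|S|)%N.
Proof.
move=> S1 ltX.
suff /exists_inP[x xX /forallP] : [exists x in X, [forall a, #|power_class x a| < #|S|]%N] by exists x.
move: ltX; apply: contraTT.
rewrite negb_exists_in -leqNgt => /forall_inP Xbad.
have /card_gt1P[u [v [uS vS uv]]] := S1.
apply: leq_trans (card_collisions e0 uv); apply: subset_leq_card; apply/subsetP=> x xX.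
have /forallPn[a] := Xbad x xX; rewrite -leqNgt => leS.
have /eqP E : power_class x a == S.
  by rewrite eqEcard leS andbT; apply/subsetP=> y; rewrite inE => /andP[].
by move: uS vS; rewrite -E !inE => /andP[_ /eqP ->] /andP[_ /eqP ->].
Qed.

Variables (k B : nat).
Hypothesis k0 : (0 < k)%N.
Hypothesis B2 : (2 < B)%N.
Hypothesis e_large : (2 * k * (B ^ k.-1 * B ^ k.-1) < e)%N.
Hypothesis p_large : (2 * k * e * B <= p)%N.

Lemma few_bad_shifts X m D : (2 * k.+1 <= m)%N -> (#|S| <= m * D)%N ->
  (forall x, x \in X -> exists a, m <= #|power_class x a|)%N ->
  (#|X| * B ^ k.-1 <= (2 * D) ^ k.+1 * (2 * k * e * B))%N.
Proof.
move=> km SmD Xbad.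
pose a x := odflt 0 [pick a | m <= #|power_class x a|]%N.
have aP x : x \in X -> (m <= #|power_class x (a x)|)%N.
  move=> xX; have [b mb] := Xbad x xX; rewrite /a; case: pickP => //= no.
  by have := no b; rewrite mb.
pose t := ((2 * k * e * B) %/ B ^ k.-1)%N.
have J0 : (0 < B ^ k.-1)%N by rewrite expn_gt0; lia.
have leXt : (#|X| <= (2 * D) ^ k.+1 * t)%N.
  have Cm : (0 < 'C(m, k.+1))%N by rewrite bin_gt0; lia.
  rewrite -(leq_pmul2r Cm) [X in (_ <= X)%N]mulnAC.
  apply: leq_trans (leq_mul (bin_leq_scaled km SmD) (leqnn t)).
  apply: (@double_count _ _ S X (fun x => power_class x (a x))) => [x xX|V cV].
    by split; [apply/subsetP=> y; rewrite inE => /andP[] | apply: aP].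
  pose v (i : 'I_k.+1) : F := enum_val (cast_ord (esym cV) i).
  have vinj : injective v by move=> i j /enum_val_inj /cast_ord_inj.
  rewrite leq_divRL //; apply: (card_projective_solutions ch k0 B2 e_large p_large vinj).
  move=> x i; rewrite inE => /andP[xX /subsetP VC].
  have Ev j : (x + v j) ^+ e = a x.
    by have := VC (v j) (enum_valP _); rewrite inE => /andP[_ /eqP].
  split; first by rewrite !Ev.
  (* If the common value were 0, every [v i] would equal [- x], against injectivity, as there are at
     least two indices. *)
  apply/eqP=> x0; have a0 : a x = 0 by rewrite -(Ev ord0) x0 expr0n eqn0Ngt e0.
  have := Ev (lift ord0 (Ordinal k0)); rewrite a0 => /eqP; rewrite expf_eq0 e0 /= -x0.
  by rewrite (inj_eq (addrI x)) (inj_eq vinj) eq_sym (negbTE (neq_lift _ _)).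
apply: leq_trans (leq_mul leXt (leqnn _)) _.
by rewrite -mulnA leq_mul2l /t leq_trunc_div orbT.
Qed.

Lemma few_common_shifts (a : 'I_k -> F) : (1 < #|S|)%N ->
  (forall u (i : 'I_k), u \in S -> (i%:R + u) ^+ e = a i) ->
  (#|S| * B ^ k.-1 <= 2 * k * e * B)%N.
Proof.
move=> S1 Sa; have kp : (k <= p)%N.
  apply: leq_trans p_large.
  rewrite (_ : 2 * k * e * B = k * (2 * e * B))%N; last by lia.
  by apply: leq_pmulr; rewrite !muln_gt0 e0 (ltn_trans _ B2).
apply: (@card_affine_solutions F p ch k e B (fun i : 'I_k => i%:R) a) => //.
- have sub_neq (i j : nat) : (i < j < k)%N -> j%:R - i%:R != 0 :> F.
    by move=> ij; rewrite -natrB ?ch //; lia.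
  move=> i j /eqP ij; apply/val_inj/eqP; case: (ltngtP i j) => // lt.
    by have := sub_neq i j; rewrite lt ltn_ord subr_eq0 eq_sym ij => /(_ isT).
  by have := sub_neq j i; rewrite lt ltn_ord subr_eq0 ij => /(_ isT).
(* The value 0 would leave [- i] as the only candidate. *)
- move=> i; apply: contraTneq S1 => a0; rewrite -leqNgt.
  have z w : w \in S -> w = - i%:R.
    move=> wS; have /eqP := Sa w i wS; rewrite a0 expf_eq0 e0 /= addrC addr_eq0.
    by move=> /eqP.
  by rewrite leqNgt; apply/negP=> /card_gt1P[u [v [uS vS]]]; rewrite (z u) // (z v) // eqxx.
- by move=> y i yS; rewrite addrC; apply: Sa.
Qed.

End Shifts.

(** * Natural numbers as elements of the prime field *)

Section Fp.
Variables (p e : nat).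
Hypothesis p_pr : prime p.

Definition shifted_power x u := ((x + u) ^ e %% p)%N.

Lemma natrFp_neq0 n : (0 < n < p)%N -> n%:R != 0 :> 'F_p.
Proof. by move=> n_p; rewrite -(dvdn_pcharf (pchar_Fp p_pr)) gtnNdvd //; case/andP: n_p. Qed.

Lemma eq_natrFp m n : (m%:R == n%:R :> 'F_p) = (m == n %[mod p])%N.
Proof. by rewrite -val_eqE /= !val_Fp_nat. Qed.

Lemma val_natrFp m : (m < p)%N -> (m%:R : 'F_p) = m :> nat.
Proof. by move=> mp; rewrite val_Fp_nat // modn_small. Qed.

Lemma shifted_power_lt x u : (shifted_power x u < p)%N.
Proof. by rewrite ltn_mod prime_gt0. Qed.

Lemma shifted_powerE x (u : 'F_p) a : (a < p)%N ->
  ((x%:R + u) ^+ e == a%:R) = (shifted_power x u == a).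
Proof.
move=> ap; rewrite -[u]natr_Zp -natrD -natrX eq_natrFp natr_Zp.
by rewrite (modn_small ap).
Qed.

Lemma card_Fp_count (S : seq nat) (P : pred nat) : uniq S -> all (fun u => u < p)%N S ->
  #|[set u : 'F_p | ((u : nat) \in S) && P u]| = count P S.
Proof.
move=> uS Sp; rewrite -size_filter cardE -(size_map val).
apply: perm_size; apply: uniq_perm; first by rewrite map_inj_uniq ?enum_uniq //; exact: val_inj.
  exact: filter_uniq.
move=> x; rewrite mem_filter; apply/mapP/andP => [[u]|[Px xS]].
  by rewrite mem_enum inE => /andP[uS' Pu] ->.
have xp := allP Sp x xS; exists (x%:R); last by rewrite /= val_natrFp.
by rewrite mem_enum inE /= val_natrFp // xS.
Qed.

Definition Fp_set (S : seq nat) := [set u : 'F_p | (u : nat) \in S].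

Lemma card_Fp_set S : uniq S -> all (fun u => u < p)%N S -> #|Fp_set S| = size S.
Proof.
move=> uS Sp; rewrite -[RHS](count_predT S) -(card_Fp_count predT uS Sp).
by apply: eq_card => u; rewrite !inE andbT.
Qed.

Lemma card_power_class S x a : uniq S -> all (fun u => u < p)%N S -> (a < p)%N ->
  #|power_class e (Fp_set S) x%:R a%:R| = count (fun u => shifted_power x u == a) S.
Proof.
move=> uS Sp ap; rewrite -(card_Fp_count _ uS Sp); apply: eq_card => u.
by rewrite !inE shifted_powerE.
Qed.

Lemma count_power_class S x a : uniq S -> all (fun u => u < p)%N S ->
  (count (fun u => shifted_power x u == a) S <= #|power_class e (Fp_set S) x%:R a%:R|)%N.
Proof.
move=> uS Sp; have [ap|pa] := ltnP a p; first by rewrite card_power_class.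
rewrite (eq_count (a2 := pred0)) ?count_pred0 // => u /=; apply/negbTE.
by apply: contraTneq pa => <-; rewrite -ltnNge shifted_power_lt.
Qed.

Definition Fp_initial h := [set x : 'F_p | (x < h)%N].

Lemma card_Fp_initial h : (h <= p)%N -> #|Fp_initial h| = h.
Proof.
move=> hp; rewrite -[RHS](size_iota 0) -(card_Fp_set (iota_uniq 0 h)).
  by apply: eq_card => x; rewrite !inE mem_iota.
by apply/allP=> x; rewrite mem_iota => /andP[_ /leq_trans]; apply.
Qed.

End Fp.

(** * Existence of a good shift, with explicit constants *)

Section GoodShift.
Variables (p e k L D : nat) (S : seq nat).
Local Open Scope nat_scope.
Hypothesis p_pr : prime p.
Hypothesis e_gt0 : 0 < e.
Hypothesis e_lt : e < p.
Hypothesis k_ge4 : 3 < k.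
Hypothesis L_gt0 : 0 < L.
Hypothesis L_leq : L <= 2 * k - 2.
Hypothesis e_pow : e ^ L.+1 <= p ^ L.
Hypothesis D_gt0 : 0 < D.

(* Below [B = D ^ k.+1] and [J = B ^ k.-1], so that [J ^ 2 = D ^ exponent] is [e] up to a constant. *)
Definition base_const := 4 * k.+1.
Definition exponent := (2 * k - 2) * k.+1.
(** The first summand serves the case of many candidates, its last factor paying for the replacement
    of [e] by [D ^ exponent]; the second serves the case [size S <= base_const * D ^ 2]. *)
Definition cost_const := 2 ^ (k + 4) * k ^ 2 * (2 * base_const) ^ exponent + 2 * base_const ^ 3.

Hypothesis e_upper : e < (base_const * D.+1) ^ exponent.
Hypothesis uS : uniq S.
Hypothesis Sp : all (fun u => u < p) S.
Hypothesis S_ge2 : 1 < size S.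
Hypothesis S_leq : size S <= e.

Definition good_shift x := forall a, count (fun u => shifted_power p e x u == a) S * minn D (size S).-1 < size S.

(** This is how [e <= p^(1 - delta)] is exploited: a factor of size up to [e^(1/L)] still fits
    between [e] and [p]. *)
Lemma mul_leq_p q : q ^ L <= e -> q * e <= p.
Proof.
move=> qe; rewrite -(leq_exp2r _ _ L_gt0) expnMn; apply: leq_trans e_pow.
by rewrite expnS leq_mul2r qe orbT.
Qed.

Lemma e_upper_mul : e <= (2 * base_const) ^ exponent * D ^ exponent.
Proof.
apply: leq_trans (ltnW e_upper) _; rewrite -expnMn; apply: leq_exp2rW.
by move: D_gt0; move: base_const => c; nia.
Qed.

(** For [D = 1] the number [e] is below the constant [(2 * base_const) ^ exponent], so a search of
    cost [e ^ 2] is still linear in [e]. *)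
Lemma good_shift_small_D : D = 1 ->
  exists2 x, good_shift x & size S * x.+1 <= cost_const * e * D ^ (3 * k.+1).
Proof.
move=> D1; have chp := natrFp_neq0 p_pr.
have [||x] := @exists_separating_shift _ e (Fp_set p S) e_gt0 (Fp_initial p e.+1).
- by rewrite card_Fp_set.
- by rewrite card_Fp_initial.
rewrite inE => lt_x xsep; exists x.
  move=> a; rewrite D1 (minn_idPl _) ?muln1; last by lia.
  apply: leq_ltn_trans (count_power_class e p_pr x a uS Sp) _.
  by rewrite natr_Zp -[X in _ < X](card_Fp_set p_pr uS Sp).
rewrite D1 exp1n muln1; have := e_upper_mul; rewrite D1 exp1n muln1 => le_e.
apply: (@leq_trans (e * (e + e))); first by apply: leq_mul => //; lia.
rewrite addnn -muln2 mulnA mulnC mulnA leq_mul2r; apply/orP; right.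
apply: leq_trans (leq_mul (leqnn 2) le_e) _; rewrite /cost_const.
apply: leq_trans (leq_addr _ _); rewrite leq_mul2r; apply/orP; right.
apply: (@leq_trans (2 ^ 1 * 1)) => //; apply: leq_mul; first by rewrite leq_exp2l //; lia.
by rewrite expn_gt0; apply/orP; left; lia.
Qed.

Section LargeD.
Hypothesis D_ge2 : 1 < D.
Hypothesis e_lower : (base_const * D) ^ exponent <= e.

Local Notation B := (D ^ k.+1).
Local Notation J := (B ^ k.-1).

Lemma JJ : J * J = D ^ exponent.
Proof. by rewrite -expnD -expnM; congr (_ ^ _); rewrite /exponent; lia. Qed.

Lemma J_gt0 : 0 < J.
Proof. by rewrite !expn_gt0 D_gt0. Qed.

Lemma B_large : 2 ^ k.+1 <= B.
Proof. exact: leq_exp2rW. Qed.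

Lemma B_gt2 : 2 < B.
Proof. by apply: leq_trans B_large; apply: (@leq_trans (2 ^ 2)) => //; rewrite leq_exp2l //; lia. Qed.

Lemma JJ_lt_e : 2 * k * (J * J) < e.
Proof.
apply: leq_trans e_lower; rewrite expnMn -JJ ltn_pmul2r; last by rewrite muln_gt0 J_gt0.
have : base_const ^ 1 <= base_const ^ exponent.
  by rewrite leq_exp2l /base_const /exponent; nia.
by rewrite expn1 {1}/base_const; lia.
Qed.

(** Since [2 * k * B <= (base_const * D) ^ k.+1], its [L]-th power is at most
    [(base_const * D) ^ exponent <= e] provided that [L <= 2 * k - 2]; this is where the condition
    on [L] comes from. *)
Lemma keB_leq_p : 2 * k * e * B <= p.
Proof.
rewrite mulnAC; apply: mul_leq_p; apply: leq_trans e_lower.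
apply: (@leq_trans ((base_const * D) ^ (k.+1 * L))).
  rewrite expnM; apply: leq_exp2rW; rewrite expnMn leq_mul2r; apply/orP; right.
  apply: (@leq_trans (base_const ^ 1)); first by rewrite expn1 /base_const; lia.
  by rewrite leq_exp2l // /base_const; lia.
by rewrite leq_exp2l /exponent /base_const; nia.
Qed.

Lemma sq_leq_p n : n <= base_const * D ^ 2 -> n * n * e < p.
Proof.
move=> nD; have H : 2 * (base_const * D ^ 2) ^ 2 * e <= p.
  apply: mul_leq_p; apply: leq_trans e_lower.
  apply: (@leq_trans ((base_const * D) ^ (4 * L))).
    rewrite expnM; apply: leq_exp2rW; have c2 : 2 <= base_const by rewrite /base_const; lia.
    move: base_const c2 => c c2; rewrite expnMn [(c * D) ^ 4]expnMn -expnM mulnA leq_mul2r; apply/orP; right.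
    by rewrite -[4]/(2 + 2) expnD leq_mul2r -mulnn; apply/orP; right; nia.
  by rewrite leq_exp2l /exponent /base_const; nia.
apply: leq_trans H; rewrite -mulnn ltn_pmul2r //.
have : 0 < base_const * D ^ 2 by rewrite muln_gt0 expn_gt0 D_gt0 /base_const.
by move: (base_const * D ^ 2) nD => m; nia.
Qed.

(** The injective shift costs about [e] times the cube of [size S], hence [e * D ^ 6] up to a
    constant, and [6 <= 3 * k.+1]. *)
Lemma good_shift_small_S : size S <= base_const * D ^ 2 ->
  exists2 x, good_shift x & size S * x.+1 <= cost_const * e * D ^ (3 * k.+1).
Proof.
move=> S_small; have lt_p := sq_leq_p S_small.
have [|x] := @exists_injective_shift _ e (Fp_set p S) e_gt0 (Fp_initial p (size S * size S * e).+1).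
  by rewrite card_Fp_set // card_Fp_initial.
rewrite inE ltnS => le_x xinj; exists x.
  move=> a; have le1 : count (fun u => shifted_power p e x u == a) S <= 1.
    by apply: leq_trans (count_power_class e p_pr x a uS Sp) _; rewrite natr_Zp.
  apply: (@leq_ltn_trans (1 * (size S).-1)); last by lia.
  by apply: leq_mul; rewrite ?geq_minr.
have D3 : D ^ 6 <= D ^ (3 * k.+1) by rewrite leq_exp2l //; lia.
have S3 : size S ^ 3 <= base_const ^ 3 * D ^ 6.
  by rewrite (expnM D 2 3) -expnMn; apply: leq_exp2rW.
apply: (@leq_trans (2 * (base_const ^ 3 * D ^ (3 * k.+1)) * e)); last first.
  rewrite mulnA [X in X <= _]mulnAC leq_mul2r; apply/orP; right.
  by rewrite leq_mul2r /cost_const leq_addl orbT.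
apply: (@leq_trans (2 * size S ^ 3 * e)).
  apply: (@leq_trans (size S * (2 * (size S * size S * e)))).
    rewrite leq_mul2l; apply/orP; right; rewrite mul2n -addnn -addn1 leq_add //.
    by rewrite !muln_gt0 e_gt0 ltnW.
  by apply: eq_leq; rewrite !expnS expn0 muln1; ring.
by rewrite leq_mul2r leq_mul2l (leq_trans S3) ?orbT // leq_mul2l D3 orbT.
Qed.

Hypothesis S_common : forall i u v, i < k -> u \in S -> v \in S ->
  shifted_power p e i u = shifted_power p e i v.

Lemma few_candidates : size S * J <= 2 * k * e * B.
Proof.
have [s0 s0S] : exists s0, s0 \in S by case: S S_ge2 => // s s1; exists s; rewrite mem_head.
have k_gt0 : 0 < k by lia.
have := @few_common_shifts _ p e (Fp_set p S) (natrFp_neq0 p_pr) e_gt0 k B k_gt0 B_gt2 JJ_lt_e keB_leq_p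
  (fun i => ((shifted_power p e i s0)%:R)%R).
rewrite card_Fp_set //; apply=> // u i; rewrite inE => uS'; apply/eqP.
by rewrite shifted_powerE // ?shifted_power_lt // (S_common (ltn_ord i) uS' s0S).
Qed.

Lemma good_shift_large_S : base_const * D ^ 2 < size S ->
  exists2 x, good_shift x & size S * x.+1 <= cost_const * e * D ^ (3 * k.+1).
Proof.
move=> S_large; have k_gt0 : 0 < k by lia.
(* [h] is the largest number of bad shifts that [few_bad_shifts] permits, so one of the [h + 1]
   shifts up to [h] is good. *)
pose h := ((2 * D) ^ k.+1 * (2 * k * e * B)) %/ J.
have le_hp : h < p.
  apply: leq_trans keB_leq_p; apply: (@leq_ltn_trans (2 * k * e)); last first.
    by rewrite ltn_Pmulr ?(ltn_trans _ B_gt2) // !muln_gt0 e_gt0 k_gt0.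
  rewrite -(leq_pmul2r J_gt0); apply: leq_trans (leq_trunc_div _ _) _.
  have -> : (2 * D) ^ k.+1 * (2 * k * e * B) = 2 * k * e * (2 ^ k.+1 * B * B).
    by rewrite expnMn; move: (2 ^ k.+1) => u; lia.
  rewrite leq_mul2l; apply/orP; right; apply: (@leq_trans (B ^ 3)).
    move: B_large; move: (2 ^ k.+1) (D ^ k.+1) => u b ub.
    by rewrite !expnS expn0 muln1 mulnA !leq_mul2r ub !orbT.
  by rewrite leq_exp2l ?(ltn_trans _ B_gt2) // -ltnS prednK.
pose bad (x : 'F_p) := [exists a : 'F_p, size S <= #|power_class e (Fp_set p S) x a| * D].
case: (boolP [exists x in Fp_initial p h.+1, ~~ bad x]) => [/exists_inP[x]|]; last first.
  rewrite negb_exists_in => /forall_inP all_bad.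
  (* This is [size S / D] rounded up. It is at least [2 * k.+1] because [size S] exceeds
     [base_const * D ^ 2]. *)
  pose m := ((size S).-1 %/ D).+1.
  have leSm : size S <= m * D.
    by have := ltn_ceil (size S).-1 D_gt0; rewrite -/m prednK // ltnW.
  have := @few_bad_shifts _ p e (Fp_set p S) (natrFp_neq0 p_pr) e_gt0 k B k_gt0 B_gt2 JJ_lt_e keB_leq_p
    (Fp_initial p h.+1) m D.
  rewrite card_Fp_set // card_Fp_initial // => H.
  have : h.+1 * J <= (2 * D) ^ k.+1 * (2 * k * e * B).
    apply: H => // [|x xX].
      rewrite leqNgt; apply/negP=> m_small.
      suff : m * D <= base_const * D ^ 2.
        by move=> /(leq_trans leSm) /(leq_trans S_large); rewrite ltnn.
      rewrite -mulnn mulnA leq_mul2r; apply/orP; right.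
      apply: leq_trans (leq_pmulr _ D_gt0); apply: leq_trans (ltnW m_small) _.
      by rewrite leq_mul2r orbT.
    have := all_bad x xX; rewrite negbK => /existsP[a Ha]; exists a.
    by rewrite /m ltn_divLR // (leq_trans _ Ha) // ltn_predL ltnW.
  by rewrite -leq_divRL ?J_gt0 // ltnn.
rewrite inE ltnS => le_x xgood; exists x.
  move=> a; rewrite (minn_idPl _); last first.
    suff : D <= base_const * D ^ 2 by move=> /leq_ltn_trans /(_ S_large) lt_D; rewrite -ltnS prednK // ltnW.
    by rewrite -mulnn mulnCA leq_pmulr // muln_gt0 D_gt0.
  rewrite /bad negb_exists in xgood; have := forallP xgood (a%:R)%R; rewrite -ltnNge.
  apply: leq_ltn_trans; rewrite leq_mul2r; apply/orP; right.
  by apply: leq_trans (count_power_class e p_pr x a uS Sp) _; rewrite natr_Zp.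
(* Both [size S * J] and [x.+1 * J] are bounded, by multiples of [e * B] and [e * B ^ 2]. In the
   product [J * J = D ^ exponent] cancels one factor [e] up to a constant, which leaves [e * B ^ 3],
   that is [e * D ^ (3 * k.+1)]. *)
have nJ := few_candidates.
have xJ : x.+1 * J <= 2 ^ k.+2 * (2 * k * e * B * B).
  apply: (@leq_trans (h.+1 * J)); first by rewrite leq_mul2r ltnS le_x orbT.
  have JeB : J <= 2 ^ k.+1 * B * (2 * k * e * B).
    apply: leq_trans (_ : e <= _).
      apply: leq_trans (ltnW JJ_lt_e); apply: leq_trans (leq_pmulr J J_gt0) _.
      by apply: leq_pmull; rewrite muln_gt0.
    rewrite mulnA [X in _ <= X](_ : _ = e * (2 ^ k.+1 * B * (2 * k) * B)); last by lia.
    by apply: leq_pmulr; rewrite !muln_gt0 !expn_gt0 D_gt0 k_gt0.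
  have := leq_trunc_div ((2 * D) ^ k.+1 * (2 * k * e * B)) J.
  rewrite -/h [(2 * D) ^ _]expnMn [h.+1 * J]mulSn [2 ^ k.+2]expnS => hJ.
  apply: leq_trans (leq_add JeB hJ) _; apply: eq_leq.
  by move: (2 ^ k.+1) (D ^ k.+1) => u b; ring.
rewrite -(leq_pmul2r J_gt0) -(leq_pmul2r J_gt0).
apply: (@leq_trans (2 * k * e * B * (2 ^ k.+2 * (2 * k * e * B * B)))).
  by rewrite [X in X <= _](_ : _ = size S * J * (x.+1 * J)); [apply: leq_mul | lia].
have -> : D ^ (3 * k.+1) = B * B * B by rewrite mulnC expnM !expnS expn0 muln1 mulnA.
rewrite -[X in _ <= X]mulnA JJ.
apply: (@leq_trans (2 ^ (k + 4) * k ^ 2 * (e * (B * B * B)) * e)).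
  rewrite -mulnn (_ : (k + 4 = k.+2.+2)%N); last by lia.
  by rewrite [2 ^ k.+4]expnS [2 ^ k.+3]expnS; move: (2 ^ k.+2) => u; lia.
rewrite /cost_const; have := e_upper_mul; move: ((2 * base_const) ^ exponent) => c1 le_e.
apply: leq_trans (leq_mul (leqnn _) le_e) _.
move: (2 ^ (k + 4) * k ^ 2) (2 * base_const ^ 3) (D ^ exponent) (D ^ k.+1) => u w d b.
have -> : u * (e * (b * b * b)) * (c1 * d) = u * c1 * (e * b * b * b * d) by ring.
have -> : (u * c1 + w) * e * (b * b * b) * d = (u * c1 + w) * (e * b * b * b * d) by ring.
by rewrite leq_mul2r leq_addr orbT.
Qed.

End LargeD.

Theorem good_shift_exists : D = 1 \/ (base_const * D) ^ exponent <= e ->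
  (1 < D -> forall i u v, i < k -> u \in S -> v \in S -> shifted_power p e i u = shifted_power p e i v) ->
  exists2 x, good_shift x & size S * x.+1 <= cost_const * e * D ^ (3 * k.+1).
Proof.
move=> D_bound S_common; have [D1|D_ge2] : D = 1 \/ 1 < D by lia.
  exact: good_shift_small_D.
have e_lower : (base_const * D) ^ exponent <= e by case: D_bound => // D1; rewrite D1 in D_ge2.
have [S_small|S_large] := leqP (size S) (base_const * D ^ 2); first exact: good_shift_small_S.
exact: good_shift_large_S D_ge2 e_lower (S_common D_ge2) S_large.
Qed.

End GoodShift.

(** * Transfer to the notions of the machine model *)

Section Translation.
Local Open Scope nat_scope.

Lemma pow_expn m n : Nat.pow m n = m ^ n.
Proof. by elim: n => [|n IH] //; rewrite expnS -IH. Qed.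

Lemma modulo_modn m d : 0 < d -> Nat.modulo m d = m %% d.
Proof.
move=> d0; symmetry; apply: (PeanoNat.Nat.mod_unique m d (m %/ d)).
  by apply/ltP; rewrite ltn_mod.
by rewrite [LHS](divn_eq m d) mulnC.
Qed.

Lemma nat_primeP p : nat_prime p -> prime p.
Proof.
move=> pp; have p2 := prime_ge_2 _ pp; apply/primeP; split; first by lia.
move=> d /dvdnP[q pE]; have : (Z.of_nat d | Z.of_nat p)%Z.
  by exists (Z.of_nat q); rewrite pE; lia.
by case/(prime_divisors _ pp) => [|[|[|]]] ?; apply/orP; [lia | left; lia | right; lia | lia].
Qed.

Lemma InP (x : nat) (s : seq nat) : reflect (In x s) (x \in s).
Proof.
elim: s => [|y s IH] /=; first by rewrite in_nil; constructor.
rewrite inE; apply: (iffP orP) => [[/eqP ->|/IH]|[->|/IH]]; auto.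
Qed.

Lemma NoDup_uniq (s : seq nat) : NoDup s -> uniq s.
Proof. by elim=> [|x t xt _ IH] //=; rewrite IH andbT; apply/InP. Qed.

Lemma shifted_shifted_power p e x u : 0 < p -> shifted p e x u = shifted_power p e x u.
Proof. by move=> p0; rewrite /shifted /shifted_power modulo_modn // pow_expn. Qed.

Lemma count_occ_count p e x S v : 0 < p ->
  count_occ Nat.eq_dec (List.map (shifted p e x) S) v = count (fun u => shifted_power p e x u == v) S.
Proof.
move=> p0; elim: S => [|u S IH] //=; rewrite IH shifted_shifted_power //.
by case: Nat.eq_dec => [->|/eqP/negbTE ->]; rewrite ?eqxx.
Qed.

Lemma exists_separates p e k L D (S : seq nat) :
  nat_prime p -> (0 < e)%coq_nat -> (e < p)%coq_nat -> (3 < k)%coq_nat -> (0 < L)%coq_nat ->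
  (L <= 2 * k - 2)%coq_nat -> (Nat.pow e L.+1 <= Nat.pow p L)%coq_nat -> (0 < D)%coq_nat ->
  (e < Nat.pow (base_const k * (D + 1)) (exponent k))%coq_nat ->
  D = 1 \/ (Nat.pow (base_const k * D) (exponent k) <= e)%coq_nat ->
  NoDup S -> (forall u, In u S -> (u < p)%coq_nat) -> (1 < length S)%coq_nat -> (length S <= e)%coq_nat ->
  (1 < D -> forall i u v, (i < k)%coq_nat -> In u S -> In v S -> shifted p e i u = shifted p e i v) ->
  exists x, separates p e D S x /\
    (length S * (x + 1) <= cost_const k * e * Nat.pow D (3 * k.+1))%coq_nat.
Proof.
move=> /nat_primeP p_pr /ltP e0 /ltP ep /ltP k3 /ltP L0 /leP Lk; rewrite !pow_expn.
move=> /leP epow /ltP D0 /ltP e_up D_low uS Sp /ltP S1 /leP Se common.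
have p0 := prime_gt0 p_pr.
have [||||x good xw] := good_shift_exists p_pr e0 ep k3 L0 Lk epow D0 _ (NoDup_uniq uS) _ S1 Se.
- by move: e_up; rewrite addn1.
- by apply/allP=> u /InP /Sp /ltP.
- by case: D_low => [|/leP]; [left | right].
- move=> D1 i u v ik /InP uS' /InP vS'.
  by rewrite -!shifted_shifted_power //; apply: common => //; apply/ltP.
exists x; split; last by apply/leP; rewrite addn1.
move=> v; rewrite count_occ_count //; apply/ltP.
have -> : Nat.min D (length S - 1) = minn D (size S).-1; last exact: good.
by rewrite /length -/(size S); move: (size S) => n; lia.
Qed.

End Translation.

End Separation.

(** * Query and time bounds *)

Section FindShift.
Variable k : nat.
Hypothesis k_ge4 : 4 <= k.

Local Notation c := (Separation.base_const k).
Local Notation K := (Separation.exponent k).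

Lemma base_constE : c = 4 * (k + 1).
Proof. change c with (4 * S k). lia. Qed.

Lemma exponentE : K = (2 * k - 2) * (k + 1).
Proof. change K with ((2 * k - 2) * S k). f_equal. lia. Qed.

Definition find_shift : com :=
  Seq (Seq relocate (compute_scale c K)) (Seq (ask_shifts k) (Seq eliminate (Do (ILoad 0 12)))).

Definition rounds : nat := (2 * c) ^ K + (2 * c + 1) * K.

(** For [D = 1] the number [e] is below the constant [(2 * c) ^ K], and [r < e]. For [D >= 2] one
    has [c * (D + 1) <= 2 * c * D <= D ^ (2 * c + 1)], so that [e < D ^ ((2 * c + 1) * K)]. *)
Lemma rounds_spec D e r : 0 < D -> e < (c * (D + 1)) ^ K ->
  2 * D ^ r <= e -> r + 2 <= e -> r <= rounds.
Proof.
  intros HD He Hr Hre. unfold rounds.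
  destruct (Nat.eq_dec D 1) as [->|HD1].
  - replace (c * (1 + 1)) with (2 * c) in He by lia. lia.
  - destruct (le_lt_dec r ((2 * c + 1) * K)) as [|Hlt]; [lia|exfalso].
    assert (H1 : (c * (D + 1)) ^ K <= D ^ ((2 * c + 1) * K)).
    { rewrite Nat.pow_mul_r. apply Nat.pow_le_mono_l. rewrite Nat.pow_add_r, Nat.pow_1_r.
      transitivity ((2 * c) * D); [nia|]. apply Nat.mul_le_mono_r.
      transitivity (2 ^ (2 * c)); [apply Nat.lt_le_incl, Nat.pow_gt_lin_r; lia|].
      apply Nat.pow_le_mono_l. lia. }
    assert (H2 : D ^ ((2 * c + 1) * K) <= D ^ r) by (apply Nat.pow_le_mono_r; lia).
    lia.
Qed.

(** Times [p ^ 2] this bounds all values in memory: [cost_const] covers the shifts reached by a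
    search, [(2 * c) ^ K] the powers tested for [D], and 200 the addresses and the products of
    residues. *)
Definition memory_factor : nat := Separation.cost_const k + (2 * c) ^ K + k + 200.

Definition step_factor : nat := 300 + 2 * K + 50 * k + 100 * (rounds + 1).

Definition cost_factor : nat :=
  step_factor * Separation.cost_const k * (2 * (bitlen memory_factor + 2)) ^ 2.

Lemma cost_const_pos : 0 < Separation.cost_const k.
Proof.
  assert (H : 0 < 2 * (c * (c * c))) by (rewrite base_constE; repeat apply Nat.mul_pos_pos; lia).
  apply (Nat.lt_le_trans _ _ _ H). apply Nat.le_add_l.
Qed.

Lemma bitlen_mul x y : bitlen (x * y) <= bitlen x + bitlen y.
Proof.
  unfold bitlen. destruct (Nat.eq_dec x 0) as [->|Hx]; [rewrite Nat.mul_0_l; lia|].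
  destruct (Nat.eq_dec y 0) as [->|Hy]; [rewrite Nat.mul_0_r; lia|].
  pose proof (Nat.log2_mul_above x y). lia.
Qed.

Lemma find_shift_correct L p e s S0 :
  0 < L -> L <= 2 * k - 2 -> nat_prime p -> 0 < e -> e < p -> e ^ (L + 1) <= p ^ L ->
  NoDup S0 -> (forall x, In x S0 -> x < p) -> length S0 <= e -> In s S0 ->
  exists fuel fin,
    exec (compile 0 find_shift) (hsp_oracle p e s) fuel (init_cfg p e S0) = Some fin /\
    mem fin 0 = s /\ nqueries fin <= k + rounds + 1 /\
    exists D, 0 < D /\ D ^ K <= e /\
      cost fin <= cost_factor * (e * D ^ (3 * (k + 1))) * bitlen p ^ 3.
Proof.
  intros HL HLk Hp He Hep Hpow Hnd HS0 Hlen Hs.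
  assert (Hp2 : 2 <= p) by (pose proof (prime_ge_2 _ Hp); lia).
  set (U := memory_factor * (p * p)).
  assert (Hc : 0 < c) by (rewrite base_constE; lia).
  assert (HK : 3 * (k + 1) <= K) by (rewrite exponentE; apply Nat.mul_le_mono_r; lia).
  assert (Hpp : p <= p * p) by nia.
  assert (HU : 10 * p * p + 100 <= U) by (unfold U, memory_factor; nia).
  assert (HUpow : (2 * c) ^ K * p <= U).
  { unfold U, memory_factor. apply Nat.mul_le_mono; lia. }
  assert (HUk : k + p <= U).
  { unfold U, memory_factor. nia. }
  assert (Horacle : forall x, hsp_oracle p e s x = shifted p e x s).
  { intro x. unfold hsp_oracle, shifted. rewrite <- pow_mod_l, Nat.Div0.add_mod_idemp_l.
    apply pow_mod_l. }
  assert (Hcand : candidates s S0 S0) by (constructor; auto).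
  set (b := bitlen p).
  assert (Hb : 1 <= b) by apply bitlen_pos.
  assert (Hsetup : ends (hsp_oracle p e s) U (Seq relocate (compute_scale c K)) (mem (init_cfg p e S0))
    (124 + e * 11 + (1 + (e + 1) * (K + 8))) 0 (fun m => exists D, (0 < D /\ D <= e) /\ e < (c * (D + 1)) ^ K /\
      (D = 1 \/ (c * D) ^ K <= e) /\ layout p e D m S0)).
  { eapply (ends_seq _ _ _ _ _ (124 + e * 11) 0 (1 + (e + 1) * (K + 8)) 0); [|lia|lia].
    apply (ends_relocate _ U p e Hp2 HU He Hep S0); auto.
    intros m1 HL1. apply (ends_compute_scale _ U p e Hp2 HU He Hep c K Hc ltac:(lia) HUpow S0); auto; [lia|].
    intros D m2 HD0 HDe HD1 HD2 HL2. exists D. auto. }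
  destruct Hsetup as (m1 & t1 & q1 & Hrun1 & Ht1 & Hq1 & D & [HD0 HDe] & HD1 & HD2 & HL1).
  assert (HDK : D ^ K <= e).
  { destruct HD2 as [->|HD2]; [rewrite Nat.pow_1_l; lia|].
    etransitivity; [|exact HD2]. apply Nat.pow_le_mono_l.
    pose proof (Nat.mul_le_mono_r 1 c D Hc). lia. }
  assert (HDp : D <= p) by lia.
  set (G := D ^ (3 * (k + 1))).
  assert (HG : G <= e) by (etransitivity; [apply Nat.pow_le_mono_r; [lia|exact HK]|exact HDK]).
  assert (HG0 : 0 < G) by (apply Nat.neq_0_lt_0, Nat.pow_nonzero; lia).
  set (w := Separation.cost_const k * e * G).
  assert (HwU : w + p <= U).
  { assert (w <= Separation.cost_const k * (p * p)).
    { unfold w. rewrite <- Nat.mul_assoc. apply Nat.mul_le_mono_l, Nat.mul_le_mono; lia. }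
    pose proof (Nat.mul_le_mono_r 1 ((2 * c) ^ K + k + 200) (p * p) ltac:(lia)).
    unfold U, memory_factor. lia. }
  set (P := fun S : list nat => forall i u v, i < k -> In u S -> In v S -> shifted p e i u = shifted p e i v).
  set (t2 := 1 + k * (length S0 * (11 * b + 28) + 6) + (2 + (rounds + 1) * (w * (11 * b + 61) + 8) + 1)).
  assert (Hrest : ends (hsp_oracle p e s) U (Seq (ask_shifts k) (Seq eliminate (Do (ILoad 0 12)))) m1 t2
    (k + (rounds + 1)) (fun m => m 0 = s)).
  { eapply (ends_seq _ _ _ _ _ (1 + k * (length S0 * (11 * b + 28) + 6)) k
      (2 + (rounds + 1) * (w * (11 * b + 61) + 8) + 1) (rounds + 1)); [|unfold t2; lia|lia].
    apply (ends_ask_shifts _ U p e D Hp2 HU He Hep HD0 HDp s Horacle S0 HS0 Hlen k m1 S0); auto.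
    intros m2 S2 HL2 HC2 Hagree.
    eapply (ends_seq _ _ _ _ _ (2 + (rounds + 1) * (w * (11 * b + 61) + 8)) (rounds + 1) 1 0); [|lia|lia].
    apply (ends_eliminate _ U p e D Hp2 HU He Hep HD0 HDp s Horacle S0 HS0 Hlen P w rounds) with (S := S2); auto.
    - intros S x HP i u v Hi Hu Hv. apply filter_In in Hu as [Hu _]. apply filter_In in Hv as [Hv _]. auto.
    - intros S HC HP Hlt.
      pose proof (candidates_len _ _ _ HC).
      destruct (@Separation.exists_separates p e k L D S) as (x & Hsep & Hx); auto; try lia.
      + now rewrite <- Nat.add_1_r.
      + apply (candidates_nodup _ _ _ HC).
      + intros u Hu. apply HS0, (candidates_incl _ _ _ HC), Hu.
      + exists x. assert (Hxw : length S * (x + 1) <= w).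
        { replace (Datatypes.S k) with (k + 1) in Hx by lia. exact Hx. }
        split; [exact Hsep|]. split; [exact Hxw|].
        pose proof (Nat.mul_le_mono_r 1 (length S) (x + 1) ltac:(lia)). lia.
    - intros r. apply rounds_spec; assumption.
    - intros i u v Hi Hu Hv. rewrite (Hagree i u Hi Hu), (Hagree i v Hi Hv). reflexivity.
    - intros m3 HL3. eapply ends_do; [reflexivity | reflexivity | rewrite (layout_S _ _ _ _ _ HL3) | | lia | simpl; lia |].
      + rewrite <- (Nat.add_0_r (p + 40)). apply (layout_elements _ _ _ _ _ HL3). simpl. lia.
      + specialize (HS0 s Hs). simpl. lia.
      + now rewrite upd_same. }
  destruct Hrest as (m2 & t2' & q2 & Hrun2 & Ht2 & Hq2 & Hm2).
  assert (Hbounded : bounded U (mem (init_cfg p e S0))).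
  { intros [|[|[|j]]]; simpl; try lia.
    destruct (Nat.lt_ge_cases j (length S0)) as [Hj|Hj]; [|rewrite nth_overflow; lia].
    specialize (HS0 _ (nth_In S0 0 Hj)). lia. }
  destruct (run_exec _ _ _ _ _ _ _ (run_seq _ _ _ _ _ _ _ _ _ _ _ Hrun1 Hrun2) Hbounded)
    as (fuel & fin & Hexec & Hmem & Hnq & Hcost).
  exists fuel, fin. split; [exact Hexec|]. split; [now rewrite Hmem|]. split; [lia|].
  exists D. split; [exact HD0|]. split; [exact HDK|].
  assert (Hsteps : t1 + t2' <= step_factor * (w * b)).
  { assert (Hew : e <= w).
    { unfold w. pose proof cost_const_pos.
      rewrite <- (Nat.mul_1_r e) at 1. rewrite <- Nat.mul_assoc.
      etransitivity; [|apply (Nat.mul_le_mono_r 1); lia].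
      rewrite Nat.mul_1_l. apply Nat.mul_le_mono_l. lia. }
    set (z := w * b).
    assert (Hwz : w <= z) by (unfold z; pose proof (Nat.mul_le_mono_l 1 b w Hb); lia).
    assert (Hnz : length S0 * b <= z) by (apply Nat.mul_le_mono_r; lia).
    assert (HA : (e + 1) * (K + 8) <= (2 * z) * (K + 8)) by (apply Nat.mul_le_mono_r; lia).
    assert (HB : k * (length S0 * (11 * b + 28) + 6) <= k * (45 * z)) by (apply Nat.mul_le_mono_l; lia).
    assert (HC : (rounds + 1) * (w * (11 * b + 61) + 8) <= (rounds + 1) * (80 * z)).
    { apply Nat.mul_le_mono_l. unfold z in *. lia. }
    assert (Hfactor : (156 + 2 * K + 45 * k + 80 * (rounds + 1)) * z <= step_factor * z).
    { apply Nat.mul_le_mono_r. unfold step_factor. lia. }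
    unfold t2 in Ht2. lia. }
  assert (HbU : bitlen U <= (bitlen memory_factor + 2) * b).
  { unfold U. pose proof (bitlen_mul memory_factor (p * p)). pose proof (bitlen_mul p p). fold b in H0.
    pose proof (Nat.mul_le_mono_l 1 b (bitlen memory_factor) Hb). lia. }
  assert (HstepU : step_cost U <= (2 * ((bitlen memory_factor + 2) * b)) ^ 2).
  { unfold step_cost. apply Nat.pow_le_mono_l. lia. }
  etransitivity; [exact Hcost|]. etransitivity; [apply Nat.mul_le_mono; [exact Hsteps|exact HstepU]|].
  apply Nat.eq_le_incl. unfold cost_factor, w, G.
  rewrite !Nat.pow_2_r. cbn [Nat.pow]. ring.
Qed.

End FindShift.

(** * Real exponents and logarithms *)

Local Open Scope R_scope.

Lemma INR_pow_ln (x : nat) (n : nat) : (0 < x)%nat -> INR (x ^ n) = exp (INR n * ln (INR x)).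
Proof.
  intro Hx. rewrite pow_INR, <- (Rpower_pow n (INR x)) by now apply lt_0_INR. reflexivity.
Qed.

(** After taking logarithms it is enough that [(L + 1)(1 - delta) <= L], which is the hypothesis on
    [L]. *)
Lemma pow_le_of_Rpower (delta : R) (L p e : nat) :
  (0 < p)%nat -> (0 < e)%nat -> 1 <= INR (L + 1) * delta ->
  INR e <= Rpower (INR p) (1 - delta) -> (e ^ (L + 1) <= p ^ L)%nat.
Proof.
  intros Hp He HL H. apply INR_le. rewrite !INR_pow_ln by assumption.
  assert (Hp1 : 1 <= INR p) by (apply (le_INR 1); lia).
  assert (He0 : 0 < INR e) by now apply lt_0_INR.
  assert (Hlp : 0 <= ln (INR p)).
  { rewrite <- ln_1. destruct Hp1 as [Hp1|<-]; [left; apply ln_increasing; lra|right; reflexivity]. }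
  assert (Hle : ln (INR e) <= (1 - delta) * ln (INR p)).
  { rewrite <- (ln_exp ((1 - delta) * ln (INR p))).
    destruct H as [H|H]; [left; now apply ln_increasing|right; now f_equal]. }
  assert (Hexp : INR (L + 1) * ln (INR e) <= INR L * ln (INR p)).
  { rewrite plus_INR in *. simpl (INR 1) in *. pose proof (pos_INR L). nra. }
  destruct Hexp as [Hexp|Hexp]; [left; now apply exp_increasing|right; now f_equal].
Qed.

Lemma pow_le_Rpower (eps : R) (D e a K : nat) :
  (0 < D)%nat -> (D ^ K <= e)%nat -> INR a <= eps * INR K -> 0 <= eps ->
  INR (D ^ a) <= Rpower (INR e) eps.
Proof.
  intros HD He Ha Heps. rewrite INR_pow_ln by assumption. unfold Rpower.
  assert (HDK : (0 < D ^ K)%nat) by (apply Nat.neq_0_lt_0, Nat.pow_nonzero; lia).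
  assert (Hln : INR K * ln (INR D) <= ln (INR e)).
  { rewrite <- (ln_exp (INR K * ln (INR D))), <- INR_pow_ln by assumption.
    apply le_INR in He. apply lt_0_INR in HDK.
    destruct He as [He|He]; [left; now apply ln_increasing|right; now f_equal]. }
  assert (HlD : 0 <= ln (INR D)).
  { rewrite <- ln_1. assert (HD1 : 1 <= INR D) by (apply (le_INR 1); lia).
    destruct HD1 as [HD1|<-]; [left; apply ln_increasing; lra|right; reflexivity]. }
  assert (Hexp : INR a * ln (INR D) <= eps * ln (INR e)).
  { transitivity (eps * INR K * ln (INR D)); [now apply Rmult_le_compat_r|].
    rewrite Rmult_assoc. now apply Rmult_le_compat_l. }
  destruct Hexp as [Hexp|Hexp]; [left; now apply exp_increasing|right; now f_equal].
Qed.

(** As [ln 2 > 1/2], both the binary logarithm of [p] and the extra 1 are at most [2 * ln p]. *)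
Lemma bitlen_le_ln (p : nat) : (2 <= p)%nat -> INR (bitlen p) <= 4 * ln (INR p).
Proof.
  intro Hp. unfold bitlen. rewrite S_INR.
  pose proof (Nat.log2_spec p ltac:(lia)) as [Hlog _].
  apply le_INR in Hlog. rewrite INR_pow_ln in Hlog by lia.
  assert (Hp2 : 2 <= INR p) by (apply (le_INR 2); lia).
  replace (INR 2) with 2 in Hlog by reflexivity.
  assert (Hln : INR (Nat.log2 p) * ln 2 <= ln (INR p)).
  { rewrite <- (ln_exp (INR (Nat.log2 p) * ln 2)).
    destruct Hlog as [Hlog|Hlog]; [left; apply ln_increasing; [apply exp_pos|assumption]|right; now f_equal]. }
  assert (Hln2 : ln 2 <= ln (INR p)).
  { destruct Hp2 as [Hp2| <-]; [left; apply ln_increasing; lra|right; reflexivity]. }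
  pose proof ln_lt_2. pose proof (pos_INR (Nat.log2 p)). nra.
Qed.

Theorem theorem3p1 :
  forall (delta eps : R), 0 < delta -> 0 < eps ->
  exists (prog : program) (C c : nat),
  forall (p e s : nat) (S0 : list nat),
    nat_prime p ->
    (0 < e)%nat ->
    Nat.divide e (p - 1) ->
    INR e <= Rpower (INR p) (1 - delta) ->
    NoDup S0 ->
    (forall x, In x S0 -> (x < p)%nat) ->
    (length S0 <= e)%nat ->
    In s S0 ->
    exists (fuel : nat) (fin : cfg),
      exec prog (hsp_oracle p e s) fuel (init_cfg p e S0) = Some fin /\
      mem fin 0 = s /\
      (nqueries fin <= C)%nat /\
      INR (cost fin) <= INR C * Rpower (INR e) (1 + eps) * (ln (INR p)) ^ c.
Proof.
  intros delta eps Hdelta Heps.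
  (* [L > 1 / delta] yields [e^(L+1) <= p^L]. [L > 3 / eps] yields
     [3 (k + 1) <= eps (2k - 2)(k + 1)], that is [D^(3(k+1)) <= e^eps]. *)
  destruct (INR_unbounded (1 / delta + 3 / eps)) as [L HL].
  assert (Hd : 0 < 1 / delta) by (apply Rdiv_lt_0_compat; lra).
  assert (He3 : 0 < 3 / eps) by (apply Rdiv_lt_0_compat; lra).
  assert (HL0 : (0 < L)%nat) by (apply INR_lt; simpl; lra).
  (* This choice gives both [k >= 4] and [L <= 2 * k - 2]. *)
  set (k := (L + 4)%nat).
  (* Of the three logarithmic factors one comes from modular exponentiation and two from the bit
     cost of an instruction; 64 is the cube of the 4 in [bitlen_le_ln]. *)
  exists (compile 0 (find_shift k)), (cost_factor k * 64 + (k + rounds k + 1))%nat, 3%nat.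
  intros p e s S0 Hp He Hdiv Hle Hnd HS0 Hlen Hs.
  assert (Hp2 : (2 <= p)%nat) by (pose proof (prime_ge_2 _ Hp); lia).
  assert (Hep : (e < p)%nat).
  { apply Nat.divide_pos_le in Hdiv; lia. }
  assert (HLdelta : 1 <= INR (L + 1) * delta).
  { rewrite plus_INR. simpl (INR 1). apply (Rmult_le_reg_r (/ delta)); [now apply Rinv_0_lt_compat|].
    rewrite Rmult_assoc, Rinv_r, Rmult_1_r by lra. unfold Rdiv in Hd, HL. lra. }
  destruct (find_shift_correct k ltac:(unfold k; lia) L p e s S0) as
    (fuel & fin & Hexec & Hmem & Hq & D & HD & HDK & Hcost);
    try assumption; [unfold k; lia|now apply (pow_le_of_Rpower delta); [lia| | |]|].
  exists fuel, fin. split; [exact Hexec|]. split; [exact Hmem|]. split; [lia|].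
  apply le_INR in Hcost. etransitivity; [exact Hcost|].
  rewrite !mult_INR, (pow_INR (bitlen p)), Rpower_plus, Rpower_1 by now apply lt_0_INR.
  assert (HG : INR (D ^ (3 * (k + 1))) <= Rpower (INR e) eps).
  { apply (pow_le_Rpower eps D e _ (Separation.exponent k)); try assumption; [|lra].
    rewrite exponentE, !mult_INR, minus_INR by (unfold k; lia).
    rewrite <- Rmult_assoc. apply Rmult_le_compat_r; [apply pos_INR|].
    rewrite mult_INR. unfold k. rewrite plus_INR. simpl (INR 2). simpl (INR 3). simpl (INR 4).
    assert (3 <= eps * INR L); [|nra].
    apply (Rmult_le_reg_l (/ eps)); [now apply Rinv_0_lt_compat|].
    rewrite <- Rmult_assoc, Rinv_l, Rmult_1_l by lra. unfold Rdiv in He3, HL. lra. }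
  pose proof (bitlen_le_ln p Hp2) as Hb. pose proof (pos_INR (bitlen p)) as Hb0.
  assert (Hb3 : INR (bitlen p) ^ 3 <= 64 * ln (INR p) ^ 3).
  { replace (64 * ln (INR p) ^ 3) with ((4 * ln (INR p)) ^ 3) by ring. apply pow_incr. lra. }
  assert (Hlnp : 0 <= ln (INR p) ^ 3) by (apply pow_le; lra).
  pose proof (pos_INR (cost_factor k)) as Hcf. pose proof (pos_INR e) as He0.
  assert (HR : 0 < Rpower (INR e) eps) by apply exp_pos.
  transitivity (INR (cost_factor k) * (INR e * Rpower (INR e) eps) * (64 * ln (INR p) ^ 3)).
  - apply Rmult_le_compat; try assumption.
    + apply Rmult_le_pos; [assumption|]. apply Rmult_le_pos; [assumption|apply pos_INR].
    + now apply pow_le.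
    + apply Rmult_le_compat_l; [assumption|]. now apply Rmult_le_compat_l.
  - rewrite plus_INR, mult_INR. replace (INR 64) with 64 by (simpl; lra).
    pose proof (pos_INR (k + rounds k + 1)) as Hr.
    assert (0 <= INR (k + rounds k + 1) * (INR e * Rpower (INR e) eps) * ln (INR p) ^ 3).
    { apply Rmult_le_pos; [|assumption]. apply Rmult_le_pos; [assumption|].
      apply Rmult_le_pos; [assumption|lra]. }
    lra.
Qed.
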